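(* Let $n\ge 2$ be an integer. For each positive integer $r<n$ let $\mathcal O_{n,r}$ denote the outer automorphism group $\operatorname{Out}(G_{n,r})$ of the Higman--Thompson group $G_{n,r}$, realized as a set of core transducers as described in the context. Then $\mathcal O_n:=\bigcup_{1\le r<n}\mathcal O_{n,r}$, with the product of core transducers described in the context (a binary operation which extends the multiplication in $\operatorname{Out}(G_{n,r})=\mathcal O_{n,r}$ for each $r$), forms a group.
   Context: Spaces. $X_n=\{0,\dots,n-1\}$; $\dot{\mathbf r}$ is a set of $r$ symbols disjoint from $X_n$ (''dotted letters''); $\mathfrak C_n=X_n^\omega$ and $\mathfrak C_{n,r}=\{ca_1a_2\ldots: c\in\dot{\mathbf r},a_i\in X_n\}$ with product topologies; $\varepsilon$ is the empty word; $W_{n,r,\varepsilon}$ is the set of finite words $ca_1\ldots a_k$, $k\ge0$, $c\in\dot{\mathbf r}$, $a_i\in X_n$; $U_\eta$ is the set of infinite sequences with prefix $\eta$. $G_{n,r}$ is the group of homeomorphisms $g$ of $\mathfrak C_{n,r}$ for which there are complete antichains (finite maximal sets of pairwise prefix-incomparable words of $W_{n,r,\varepsilon}$) $\{\eta_i\}_{i<k}$, $\{\zeta_i\}_{i<k}$ with $(\eta_ix)g=\zeta_ix$ for all $i$, $x\in\mathfrak C_n$. Transducers for $\mathfrak C_{n,r}$. $A_{q_0}=(\dot{\mathbf r},X_n,R,S,\pi,\lambda,q_0)$ with state set $Q=R\sqcup S$ ($R$ finite, $S$ at most countable), $q_0\in R$, and $\pi(x,q)\in Q\setminus\{q_0\}$,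 $\lambda(x,q)$ a finite word, defined for $x\in\dot{\mathbf r}$ if $q=q_0$ and for $x\in X_n$ if $q\neq q_0$, such that: (1) $\pi(x,q)\in R$ implies $q\in R$, $\lambda(x,q)=\varepsilon$; (2) $q\in R$, $\pi(x,q)\in S$ implies $\lambda(x,q)\in W_{n,r,\varepsilon}$; (3) $q\in S$ implies $\pi(x,q)\in S$, $\lambda(x,q)\in X_n^*$; and with the extensions $\pi(\mu\nu,q)=\pi(\nu,\pi(\mu,q))$, $\lambda(\mu\nu,q)=\lambda(\mu,q)\lambda(\nu,\pi(\mu,q))$ (also to infinite inputs), (4) $\pi(w,q)=q$ with $w$ nonempty implies $\lambda(w,q)\neq\varepsilon$; (5) for $q\in S$ and $x\in \mathfrak C_n$, $\lambda(x,q)\in\mathfrak C_n$. Each state $q$ induces a map $h_q:x\mapsto\lambda(x,q)$, and $A_{q_0}$ represents $h_{q_0}:\mathfrak C_{n,r}\to\mathfrak C_{n,r}$. It is minimal if every state is $\pi(\nu,q_0)$ for some $\nu$, if for every nonempty valid input word $\nu$ the word $\lambda(\nu,q_0)$ is the longest common prefix of $U_\nu h_{q_0}$, and if distinct states in $Q\setminus\{q_0\}$ induce distinct maps. Each homeomorphism $h$ representable by a finite transducer has a minimal one $A_h$, unique up to isomorphism. A transducer over $X_n$ (without initial state) is $T=\langle X_n,Q,\pi,\lambda\rangle$ with $\pi:X_n\times Q\to Q$, $\lambda:X_n\times Q\to X_n^*$, such that infinite inputs yield infinite outputs; $h_q:\mathfrak C_n\to\mathfrak C_n$ is the map induced by the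 state $q$. Transducers over $X_n$ are identified when strongly isomorphic (a bijection of states commuting with $\pi$ and $\lambda$). Synchronization and core. A transducer is strongly synchronizing if for some $m$, for every valid input word $w$ of length $m$, $\pi(w,q)$ takes the same value $\mathfrak s(w)$ for all states $q$ from which $w$ can be read (words with a dotted first letter are read only from $q_0$, words over $X_n$ from every state other than $q_0$). Its core, $\operatorname{Core}(A)$, is the transducer over $X_n$ obtained by restricting $\pi,\lambda$ to the set of states $\{\mathfrak s(w): w\in X_n^m\}$ (this does not depend on $m$). $\mathcal B_{n,r}$ is the group of homeomorphisms $h$ of $\mathfrak C_{n,r}$ such that $h$ and $h^{-1}$ are both representable by finite strongly synchronizing transducers. $\mathcal O_{n,r}=\{\operatorname{Core}(A_g): g\in\mathcal B_{n,r}\}$. Every automorphism of $G_{n,r}$ is conjugation by a unique $g\in\mathcal B_{n,r}$, and $\operatorname{Out}(G_{n,r})$ is identified with $\mathcal O_{n,r}$ by sending the class of this automorphism to $\operatorname{Core}(A_g)$. Product $T_1T_2$. (a) Form the full product $T_1*T_2$ with states $Q_{T_1}\times Q_{T_2}$, $\pi(x,(p,q))=(\pi_{1}(x,p),\pi_{2}(\lambda_{1}(x,p),q))$, $\lambda(x,(p,q))=\lambda_{2}(\lambda_{1}(x,p),q)$. (b) Remove incomplete response: writing $e_s$ for the longest common prefix of the image of $h_s$, replace each output $\lambda(x,s)$ by the word obtained from $\lambda(x,s)e_{\pi(x,s)}$ by deleting its prefix $e_s$. (c) Pass to the core. (d) Identify states inducing equal maps on $\mathfrak C_n$. *)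

(* Defs.v *)
From HB Require Import structures.
From mathcomp Require Import all_boot.
From mathcomp Require Import boolp classical_sets functions cardinality.
From mathcomp Require Import topology function_spaces.

Set Implicit Arguments.
Unset Strict Implicit.
Unset Printing Implicit Defensive.

Local Open Scope classical_set_scope.
Local Open Scope quotient_scope.

(* The alphabet X_n is 'I_n and the dotted letters are 'I_r; a sequence that
   starts with a dotted letter is encoded as a pair (dotted letter, rest), so
   the two alphabets are disjoint by construction. *)

Definition cantor (n : nat) : topologicalType :=
  prod_topology (fun _ : nat => discrete_topology 'I_n).

Definition dcantor (n r : nat) : topologicalType :=
  (discrete_topology 'I_r * cantor n)%type.

(* W_{n,r,epsilon} *)
Definition dword (n r : nat) : Type := ('I_r * seq 'I_n)%type.

Section Words.
Variables n r : nat.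

Definition stream_take (x : cantor n) (k : nat) : seq 'I_n :=
  mkseq (fun i => x i : 'I_n) k.

Definition stream_prefix (w : seq 'I_n) (x : cantor n) : Prop :=
  w = stream_take x (size w).

Definition stream_cat (w : seq 'I_n) (x : cantor n) : cantor n :=
  fun i => nth (x (i - size w)) w i.

Definition dcat (u : dword n r) (x : cantor n) : dcantor n r :=
  (u.1, stream_cat u.2 x).

(* A finite prefix of a point of C_{n,r} is either empty ([None]) or a word
   of W_{n,r,epsilon}. *)
Definition dprefix (u : option (dword n r)) (y : dcantor n r) : Prop :=
  if u is Some (c, w) then c = y.1 /\ stream_prefix w y.2 else True.

Definition dsize (u : option (dword n r)) : nat :=
  if u is Some (_, w) then (size w).+1 else 0.

Definition cylinder (u : dword n r) : set (dcantor n r) :=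
  [set y | dprefix (Some u) y].

Definition longest_common_prefix (X : set (cantor n)) (w : seq 'I_n) : Prop :=
  (forall x, X x -> stream_prefix w x) /\
  (forall v, (forall x, X x -> stream_prefix v x) -> size v <= size w).

Definition dlongest_common_prefix (X : set (dcantor n r))
    (u : option (dword n r)) : Prop :=
  (forall y, X y -> dprefix u y) /\
  (forall v, (forall y, X y -> dprefix v y) -> dsize v <= dsize u).

Definition dcomparable (u v : dword n r) : Prop :=
  u.1 = v.1 /\ (prefix u.2 v.2 || prefix v.2 u.2).

(* A finite antichain is maximal when every word is comparable with one of
   its elements. *)
Definition complete_antichain (k : nat) (eta : 'I_k -> dword n r) : Prop :=
  (forall i j, dcomparable (eta i) (eta j) -> i = j) /\
  (forall w, exists i, dcomparable w (eta i)).

End Words.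

Definition mutually_inverse_homeos (X : topologicalType) (g h : X -> X) : Prop :=
  [/\ cancel g h, cancel h g, continuous g & continuous h].

Definition higman_thompson (n r : nat) : set (dcantor n r -> dcantor n r) :=
  [set g | (exists h, mutually_inverse_homeos g h) /\
    exists k (eta zeta : 'I_k -> dword n r),
      [/\ complete_antichain eta, complete_antichain zeta &
          forall i x, g (dcat (eta i) x) = dcat (zeta i) x]].

(* Maps act on the right, so [f \; g] (first f, then g) is the product fg. *)
Definition automorphism_of_higman_thompson (n r : nat)
    (alpha : (dcantor n r -> dcantor n r) -> (dcantor n r -> dcantor n r)) :
    Prop :=
  set_bij (@higman_thompson n r) (@higman_thompson n r) alpha /\
  {in @higman_thompson n r &, forall f g,
     alpha (f \; g) = (alpha f \; alpha g)}.

Section Automata.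
Variables (n : nat) (Q : Type) (d : 'I_n -> Q -> Q).

Definition run (w : seq 'I_n) (q : Q) : Q := foldl (fun p a => d a p) q w.

Definition synchronizing_at_level (m : nat) : Prop :=
  forall w, size w = m -> forall p q, run w p = run w q.

(* The states s(w), |w| = m; they do not depend on the choice of the level. *)
Definition core_state (q : Q) : Prop :=
  exists m, synchronizing_at_level m /\
    exists w, size w = m /\ forall p, run w p = q.

Lemma core_state_closed a q : core_state q -> core_state (d a q).
Proof.
move=> [m [sync_m [w [sz_w w_q]]]]; exists m; split=> //.
have run_wa p : run (rcons w a) p = d a q.
  by rewrite /run foldl_rcons -/(run w p) w_q.
case def_wa: (rcons w a) run_wa => [|b v] run_wa; first by case: (w) def_wa.
have sz_v : size v = m.
  by apply: succn_inj; rewrite -sz_w -(size_rcons w a) def_wa.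
by exists v; split=> // p; rewrite (sync_m v sz_v p (d b p)) -(run_wa p).
Qed.

End Automata.

(* That infinite inputs yield infinite outputs is the separate predicate
   [productive], so that the steps of the product below are total operations.
   It holds for every core of a transducer for C_{n,r}. *)
Record transducer (n : nat) := Transducer {
  state : choiceType;
  pi : 'I_n -> state -> state;
  lam : 'I_n -> state -> seq 'I_n }.

Section Transducers.
Variable n : nat.
Implicit Types T U : transducer n.

Fixpoint lamw T (w : seq 'I_n) (q : state T) : seq 'I_n :=
  if w is a :: v then lam a q ++ lamw v (pi a q) else [::].

Definition productive T : Prop :=
  forall (q : state T) (x : cantor n) (N : nat),
    exists k, N <= size (lamw (stream_take x k) q).

(* For a productive transducer the i-th letter of the output is read off any
   finite output of length greater than i; the default [x i] of [nth] is then
   never used. *)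
Definition state_map T (q : state T) (x : cantor n) : cantor n := fun i =>
  let k := xget 0 [set k | i < size (lamw (stream_take x k) q)] in
  nth (x i) (lamw (stream_take x k) q) i.

Definition strongly_isomorphic T U : Prop :=
  exists f : state T -> state U, bijective f /\
    forall a q, f (pi a q) = pi a (f q) /\ lam a (f q) = lam a q.

Definition full_product T U : transducer n :=
  @Transducer n (state T * state U)%type
    (fun a p => (pi a p.1, run (@pi n U) (lam a p.1) p.2))
    (fun a p => lamw (lam a p.1) p.2).

(* [::] is a junk value, used only when the image of [q] is a single point (or
   empty) and so has no longest common prefix. *)
Definition image_prefix T (q : state T) : seq 'I_n :=
  xget [::] [set w | longest_common_prefix (range (state_map q)) w].

Definition remove_incomplete_response T : transducer n :=
  @Transducer n (state T) (@pi n T)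
    (fun a q => drop (size (image_prefix q)) (lam a q ++ image_prefix (pi a q))).

Definition restrict T (P : pred (state T))
    (P_closed : forall a q, P q -> P (pi a q)) : transducer n :=
  @Transducer n {q : state T | P q}
    (fun a q => exist _ (pi a (val q)) (P_closed a (val q) (valP q)))
    (fun a q => lam a (val q)).

Definition core_pred T : pred (state T) :=
  fun q => `[< core_state (@pi n T) q >].

Lemma core_pred_closed T a (q : state T) : core_pred q -> core_pred (pi a q).
Proof. by move=> /asboolP q_core; apply/asboolP/core_state_closed. Qed.

Definition core T : transducer n := restrict (@core_pred_closed T).

Definition same_map T : rel (state T) :=
  fun p q => `[< state_map p = state_map q >].

Lemma same_map_refl T : reflexive (@same_map T).
Proof. by move=> p; apply/asboolP. Qed.

Lemma same_map_sym T : symmetric (@same_map T).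
Proof. by move=> p q; apply/asboolP/asboolP. Qed.

Lemma same_map_trans T : transitive (@same_map T).
Proof.
by move=> q p s /asboolP pq /asboolP qs; apply/asboolP; rewrite pq.
Qed.

Definition same_map_equiv T : equiv_rel (state T) :=
  EquivRel (@same_map T) (@same_map_refl T) (@same_map_sym T)
    (@same_map_trans T).

(* Outputs are computed on representatives; when no state has incomplete
   response, states inducing the same map have the same outputs. *)
Definition identify_states T : transducer n :=
  @Transducer n {eq_quot (same_map_equiv T)}
    (fun a q => \pi_({eq_quot (same_map_equiv T)}) (pi a (repr q)))
    (fun a q => lam a (repr q)).

Definition tmul T U : transducer n :=
  identify_states (core (remove_incomplete_response (full_product T U))).

End Transducers.

Section DottedTransitions.
Variables (n r : nat) (R : Type) (T : transducer n).

(* What is known after reading a word: either a state of R, with no output so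
   far, or a state of S together with the output, a word of W_{n,r,epsilon}. *)
Definition config : Type := (R + state T * dword n r)%type.

Definition config_state (c : config) : R + state T :=
  match c with inl q => inl q | inr (s, _) => inr s end.

Definition config_output (c : config) : option (dword n r) :=
  match c with inl _ => None | inr (_, u) => Some u end.

Variable rstep : 'I_n -> R -> config.

Definition config_step (a : 'I_n) (c : config) : config :=
  match c with
  | inl q => rstep a q
  | inr (s, (d, w)) => inr (pi a s, (d, w ++ lam a s))
  end.

Definition rs_pi (a : 'I_n) (q : R + state T) : R + state T :=
  match q with
  | inl p => config_state (rstep a p)
  | inr s => inr (pi a s)
  end.

End DottedTransitions.

(* Transducers for C_{n,r}.  The initial state q_0 is implicit: [rstate] is
   R minus q_0, [spart] is the restriction to S, and [start c] is the pair of
   pi(c, q_0) and lambda(c, q_0).  The typing ensures that outputs within R are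
   empty, that a step from R to S outputs a word of W_{n,r,epsilon}, and that S
   is closed and outputs words over X_n.  A loop pi(w, q) = q with w nonempty
   must have a nonempty output: for q in R this says that there is no loop,
   and for q in S it follows from [spart_productive] applied to the input
   w^omega. *)
Record dtransducer (n r : nat) := DTransducer {
  rstate : finType;
  spart : transducer n;
  start : 'I_r -> config r rstate spart;
  rstep : 'I_n -> rstate -> config r rstate spart;
  spart_countable : countable [set: state spart];
  rstate_acyclic : forall (q : rstate) (w : seq 'I_n), w != [::] ->
    run (rs_pi rstep) w (inl q) <> inl q;
  spart_productive : productive spart }.

Section DottedTransducers.
Variables n r : nat.
Implicit Types (A : dtransducer n r) (g : dcantor n r -> dcantor n r).

Definition config_run A (w : seq 'I_n) (c : config r (rstate A) (spart A)) :=
  run (config_step (@rstep n r A)) w c.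

(* Reading the infinite word x from c outputs y.  By [rstate_acyclic] and
   [spart_productive] the finite outputs are arbitrarily long, so y is
   determined by these prefixes. *)
Definition outputs A (c : config r (rstate A) (spart A)) (x : cantor n)
    (y : dcantor n r) : Prop :=
  forall k, dprefix (config_output (config_run (stream_take x k) c)) y.

Definition represents A g : Prop :=
  forall c x, outputs (start A c) x (g (c, x)).

Definition finite_dtransducer A : Prop :=
  finite_set [set: state (spart A)].

(* Words starting with a dotted letter are read from q_0 only, so they impose
   no condition. *)
Definition strongly_synchronizing A : Prop :=
  exists m, synchronizing_at_level (rs_pi (@rstep n r A)) m.

(* A is minimal and represents g.  A state of R and a state of S never induce
   the same map, as only the former outputs dotted letters. *)
Definition minimal_for A g : Prop :=
  [/\ represents A g,
      forall q, exists c w, config_state (config_run w (start A c)) = q,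
      forall c w, dlongest_common_prefix (g @` cylinder (c, w))
                    (config_output (config_run w (start A c))),
      forall p q : rstate A,
        (forall x y, outputs (inl p) x y <-> outputs (inl q) x y) -> p = q &
      forall p q : state (spart A), state_map p = state_map q -> p = q].

(* All states of the core lie in S: R has no cycle, so long enough words lead
   into S. *)
Definition dcore_pred A : pred (state (spart A)) :=
  fun s => `[< core_state (rs_pi (@rstep n r A)) (inr s) >].

Lemma dcore_pred_closed A a (s : state (spart A)) :
  dcore_pred s -> dcore_pred (pi a s).
Proof.
by move=> /asboolP s_core; apply/asboolP; exact: (core_state_closed a s_core).
Qed.

Definition dcore A : transducer n := restrict (@dcore_pred_closed A).

Definition fin_sync_representable g : Prop :=
  exists A, [/\ finite_dtransducer A, strongly_synchronizing A & represents A g].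

(* The group B_{n,r} *)
Definition bisynchronizing g : Prop :=
  exists h, [/\ mutually_inverse_homeos g h, fin_sync_representable g &
                fin_sync_representable h].

(* T is Core(A_g), up to strong isomorphism *)
Definition is_core_of g (T : transducer n) : Prop :=
  exists A, minimal_for A g /\ strongly_isomorphic T (dcore A).

(* alpha is conjugation f |-> g^-1 f g by an element g of B_{n,r} such that
   T is Core(A_g), i.e. the class of alpha in Out(G_{n,r}) is identified
   with T. *)
Definition outer_class_is
    (alpha : (dcantor n r -> dcantor n r) -> (dcantor n r -> dcantor n r))
    (T : transducer n) : Prop :=
  exists g, [/\ bisynchronizing g,
    forall f, higman_thompson f -> (g \; alpha f) = (f \; g) & is_core_of g T].

End DottedTransducers.

(* O_{n,r} *)
Definition outer_core (n r : nat) (T : transducer n) : Prop :=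
  exists g : dcantor n r -> dcantor n r, bisynchronizing g /\ is_core_of g T.

(* O_n *)
Definition some_outer_core (n : nat) (T : transducer n) : Prop :=
  exists r, 1 <= r < n /\ outer_core r T.

(* eqv plays the role of equality on G. *)
Definition forms_group (X : Type) (eqv : X -> X -> Prop) (G : X -> Prop)
    (mul : X -> X -> X) : Prop :=
  [/\ forall x y, G x -> G y -> G (mul x y),
      forall x x' y y', G x -> G x' -> G y -> G y' ->
        eqv x x' -> eqv y y' -> eqv (mul x y) (mul x' y'),
      forall x y z, G x -> G y -> G z ->
        eqv (mul (mul x y) z) (mul x (mul y z)) &
      exists e, [/\ G e,
        forall x, G x -> eqv (mul e x) x /\ eqv (mul x e) x &
        forall x, G x -> exists y,
          [/\ G y, eqv (mul x y) e & eqv (mul y x) e]]].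

(* Main.v *)
(* A homeomorphism g of C_{n,r} acts on each sufficiently small cylinder U_nu
   as nu x |-> mu phi(x), where phi is a self-map of C_n whose image has empty
   longest common prefix. That g is representable by a synchronizing transducer
   means that phi depends only on a long enough suffix of nu, and Core(A_g) is
   determined, up to strong isomorphism, by the set [core_maps g] of these maps
   phi. The product of cores corresponds to composition, which gives closure,
   associativity, the unit and inverses inside each O_{n,r}.

   To multiply elements of different O_{n,r}, all of them are moved to
   O_{n,n-1}: the disjoint union of n-1 copies of g acts on
   C_{n,r(n-1)}, which is homeomorphic by a prefix exchange to C_{n,n-1}
   because r(n-1) = n-1 modulo n-1, and neither step changes [core_maps g]. *)
Require Import Defs.
From mathcomp Require Import all_boot.
From mathcomp Require Import boolp classical_sets functions cardinality.
From mathcomp Require Import topology function_spaces zify.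
(* [all_boot] rebinds [pi]. *)
Import Defs.

Set Implicit Arguments.
Unset Strict Implicit.
Unset Printing Implicit Defensive.

Local Open Scope classical_set_scope.

(** * Streams over a finite alphabet *)

(** A set of maps can stand for a transducer because of a cancellation law: when the image of phi
    has empty longest common prefix, the map x |-> u phi(x) determines both u and phi. A transducer
    whose states induce distinct maps of this kind is therefore recovered, outputs and transitions
    included, from the set of these maps ([coded_iso]).

    Two existence statements carry the weight. Compositions, inverses and lifts all need a
    transducer A_g, so a minimal one is built from g alone, with restrictions of g as states. And fg
    must synchronize: the second factor reads the output of the first, so long inputs have to force
    long outputs, uniformly in the input and in the state; this uniformity is a compactness
    argument.

    Splitting a cylinder into its n children adds n-1 cylinders, which is why the number of dotted
    letters matters only modulo n-1; r-1 such splittings turn n-1 cylinders into r(n-1). *)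

Section Streams.
Variable n : nat.
Implicit Types (u v w : seq 'I_n) (x y : cantor n).

Definition stream_drop k x : cantor n := fun i => x (k + i).

Lemma size_stream_take x k : size (stream_take x k) = k.
Proof. by rewrite size_mkseq. Qed.

Lemma nth_stream_take (d : 'I_n) x k i :
  i < k -> nth d (stream_take x k) i = x i.
Proof. by move=> ik; rewrite nth_mkseq. Qed.

Lemma stream_take_eq x y k :
  stream_take x k = stream_take y k <-> forall i, i < k -> x i = y i.
Proof.
split=> [xy i ik|xy].
  by rewrite -(nth_stream_take (x i) x ik) xy nth_stream_take.
apply: (@eq_from_nth _ (x 0)); rewrite !size_stream_take// => i ik.
by rewrite !nth_stream_take// xy.
Qed.

Lemma stream_catE_lt (d : 'I_n) w x i :
  i < size w -> stream_cat w x i = nth d w i.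
Proof. by move=> iw; apply: set_nth_default. Qed.

Lemma stream_catE_ge w x i : size w <= i -> stream_cat w x i = x (i - size w).
Proof. by move=> wi; rewrite /stream_cat nth_default. Qed.

Lemma stream_cat0 x : stream_cat [::] x = x.
Proof. by apply: funext => i; rewrite stream_catE_ge ?subn0. Qed.

Lemma stream_drop_cat w x : stream_drop (size w) (stream_cat w x) = x.
Proof.
by apply: funext => i; rewrite /stream_drop stream_catE_ge ?leq_addr// addKn.
Qed.

Lemma stream_cat_inj w : injective (stream_cat w).
Proof. by move=> x y xy; rewrite -(stream_drop_cat w x) xy stream_drop_cat. Qed.

Lemma stream_cat_catl u v x :
  stream_cat (u ++ v) x = stream_cat u (stream_cat v x).
Proof.
apply: funext => i; have [iu|ui] := ltnP i (size u).
  by rewrite /stream_cat nth_cat iu; apply: set_nth_default.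
rewrite [RHS]stream_catE_ge// /stream_cat nth_cat ltnNge ui/=.
by rewrite size_cat subnDA.
Qed.

Lemma stream_take_cat w x : stream_take (stream_cat w x) (size w) = w.
Proof.
apply: (@eq_from_nth _ (x 0)); rewrite size_stream_take// => i iw.
by rewrite nth_stream_take// (stream_catE_lt (x 0)).
Qed.

Lemma stream_take_drop k x : stream_cat (stream_take x k) (stream_drop k x) = x.
Proof.
apply: funext => i; have [ik|ki] := ltnP i k.
  by rewrite (stream_catE_lt (x 0)) ?size_stream_take// nth_stream_take.
by rewrite stream_catE_ge ?size_stream_take// /stream_drop subnKC.
Qed.

Lemma stream_takeD x j k :
  stream_take x (j + k) = stream_take x j ++ stream_take (stream_drop j x) k.
Proof.
apply: (@eq_from_nth _ (x 0)); first by rewrite size_cat !size_stream_take.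
move=> i; rewrite size_stream_take => ijk.
rewrite nth_stream_take// nth_cat size_stream_take.
by case: ltnP => ij; rewrite nth_stream_take// /stream_drop ?subnKC//; lia.
Qed.

Lemma stream_prefix_cat w x : stream_prefix w (stream_cat w x).
Proof. by rewrite /stream_prefix stream_take_cat. Qed.

Lemma stream_prefixP w x :
  stream_prefix w x <-> stream_cat w (stream_drop (size w) x) = x.
Proof.
split=> [w_x|<-]; last exact: stream_prefix_cat.
by rewrite {1}w_x stream_take_drop.
Qed.

Lemma stream_prefix_drop w x :
  stream_prefix w x -> stream_cat w (stream_drop (size w) x) = x.
Proof. by move/stream_prefixP. Qed.

Lemma stream_prefix_nth (d : 'I_n) w x i :
  stream_prefix w x -> i < size w -> nth d w i = x i.
Proof. by move=> w_x iw; rewrite w_x nth_stream_take. Qed.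

Lemma stream_prefix_leq u v x :
  stream_prefix u x -> stream_prefix v x -> size u <= size v ->
  exists w, v = u ++ w.
Proof.
move=> u_x v_x uv; exists (stream_take (stream_drop (size u) x) (size v - size u)).
by rewrite {1}v_x -{1}(subnKC uv) stream_takeD -u_x.
Qed.

Lemma stream_prefix_catl u v x :
  stream_prefix (u ++ v) x -> stream_prefix u x.
Proof.
by move/stream_prefix_drop <-; rewrite stream_cat_catl; exact: stream_prefix_cat.
Qed.

Lemma stream_prefix_cat2 u v x :
  stream_prefix (u ++ v) (stream_cat u x) <-> stream_prefix v x.
Proof.
split=> [/stream_prefix_drop|/stream_prefix_drop <-].
  by rewrite stream_cat_catl => /stream_cat_inj <-; exact: stream_prefix_cat.
by rewrite -stream_cat_catl; exact: stream_prefix_cat.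
Qed.

Lemma stream_eq x y :
  (forall k, exists w, [/\ k <= size w, stream_prefix w x & stream_prefix w y]) ->
  x = y.
Proof.
move=> xy; apply: funext => i; have [w [iw w_x w_y]] := xy i.+1.
by rewrite -(stream_prefix_nth (x i) w_x)// (stream_prefix_nth (x i) w_y).
Qed.

Lemma take_stream_take x j k : j <= k -> take j (stream_take x k) = stream_take x j.
Proof.
by move=> jk; rewrite -(subnKC jk) stream_takeD take_size_cat ?size_stream_take.
Qed.

(* A König's-lemma argument: were the conclusion false, one could descend
   forever through words with arbitrarily long bad extensions. *)
Lemma fan_theorem (good : seq 'I_n -> Prop) :
  (forall u v, good u -> good (u ++ v)) ->
  (forall x, exists k, good (stream_take x k)) ->
  exists K, forall w, K <= size w -> good w.
Proof.
move=> good_cat good_x; apply: contrapT => bad.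
pose inf u := forall K, exists v, K <= size v /\ ~ good (u ++ v).
have inf0 : inf [::].
  move=> K; apply: contrapT => noK; apply: bad; exists K => w Kw.
  by apply: contrapT => bad_w; apply: noK; exists w.
have infS u : inf u -> exists a, inf (rcons u a).
  move=> inf_u; apply: contrapT => fin_a.
  have {}fin_a a : exists K, forall v, K <= size v -> good (rcons u a ++ v).
    apply: contrapT => noK; apply: fin_a; exists a => K.
    apply: contrapT => noKv; apply: noK; exists K => v Kv.
    by apply: contrapT => bad_v; apply: noKv; exists v.
  have [K K_good] := choice fin_a.
  have [[|a v] []//= /ltnSE Kv] := inf_u (\max_a K a).+1.
  rewrite -cat_rcons; apply; apply: K_good.
  by apply: leq_trans Kv; exact: leq_bigmax.
have [a0 _] := infS _ inf0.
have /choice[f infSf] : forall u, exists a, inf u -> inf (rcons u a).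
  move=> u; have [/infS[a inf_ua]|fin_u] := pselect (inf u); first by exists a.
  by exists a0 => /fin_u.
pose W k := iter k (fun u => rcons u (f u)) [::].
have sz_W k : size (W k) = k by elim: k => //= k IH; rewrite size_rcons IH.
have inf_W k : inf (W k) by elim: k => //= k; apply: infSf.
pose x : cantor n := fun i => f (W i).
have W_x k : W k = stream_take x k.
  elim: k => // k IH; rewrite -addn1 stream_takeD -IH cats1 addn1 /=.
  by rewrite /stream_drop addn0.
have [k good_k] := good_x x.
have [v [_]] := inf_W k 0; apply; rewrite W_x; exact: good_cat.
Qed.

End Streams.

(** * Transducers determined by their state maps *)

Section CompleteResponse.
Variable n : nat.
Implicit Types (u v w : seq 'I_n) (x y : cantor n) (phi psi : cantor n -> cantor n).

(** For n >= 2 this means that the longest common prefix of the image is empty; for a state map it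
    says that the state has no incomplete response. *)
Definition complete_response phi : Prop := exists x y, phi x 0 <> phi y 0.

(** Both u and v are prefixes of every common value, so the longer one, say v, is u w. Then phi(z) =
    w psi(z), and a letter of w would begin every value of phi. *)
Lemma complete_response_cat_inj u v phi psi :
  complete_response phi -> complete_response psi ->
  (forall x, stream_cat u (phi x) = stream_cat v (psi x)) ->
  u = v /\ phi = psi.
Proof.
wlog uv : u v phi psi / size u <= size v => [wlog_uv|].
  move=> phiC psiC uv; have [|/ltnW vu] := leqP (size u) (size v).
    by move/wlog_uv; apply.
  by case: (wlog_uv _ _ _ _ vu psiC phiC (fun x => esym (uv x))) => -> ->.
move=> [x [y phi_xy]] _ uv_eq.
have [w def_v] : exists w, v = u ++ w.
  apply: (stream_prefix_leq (x := stream_cat u (phi x))) => //.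
    exact: stream_prefix_cat.
  by rewrite uv_eq; exact: stream_prefix_cat.
rewrite {}def_v in uv uv_eq *.
have phiE z : phi z = stream_cat w (psi z).
  by apply: (@stream_cat_inj _ u); rewrite uv_eq stream_cat_catl.
case: w => [|a w] in phiE uv uv_eq *.
  rewrite cats0; split=> //; apply: funext => z.
  by rewrite phiE stream_cat0.
by case: phi_xy; rewrite !phiE.
Qed.

Lemma complete_response_factor psi x y : psi x <> psi y ->
  exists u phi, complete_response phi /\
    forall z, psi z = stream_cat u (phi z).
Proof.
move=> psi_xy.
pose differ N := `[< exists x y, psi x N <> psi y N >].
have exN : exists N, differ N.
  apply: contrapT => noN; apply: psi_xy; apply: funext => i.
  by apply: contrapT => xy_i; apply: noN; exists i; apply/asboolP; exists x, y.
(* N is the first position at which two values differ: the letters before it are common to all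
   values, and dropping them leaves a map with complete response. *)
have [N /asboolP[x1 [y1 xyN]] N_min] := ex_minnP exN.
have psi_const i z z' : i < N -> psi z i = psi z' i.
  move=> iN; apply: contrapT => zz'; have : N <= i.
    by apply: N_min; apply/asboolP; exists z, z'.
  by rewrite leqNgt iN.
exists (stream_take (psi x) N), (fun z => stream_drop N (psi z)); split.
  by exists x1, y1; rewrite /stream_drop addn0.
move=> z; rewrite -{1}(stream_take_drop N (psi z)); congr stream_cat.
by apply/stream_take_eq => i iN; apply: psi_const.
Qed.

Lemma injective_factor psi : 1 < n -> injective psi ->
  exists u phi, complete_response phi /\ forall z, psi z = stream_cat u (phi z).
Proof.
move=> n1 psi_inj; pose x : cantor n := fun=> Ordinal (ltnW n1).
pose y : cantor n := fun=> Ordinal n1.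
apply: (@complete_response_factor _ x y) => /psi_inj.
by move/(congr1 (fun z : cantor n => val (z 0))).
Qed.

Lemma complete_response_leq u v phi : complete_response phi ->
  (forall z, stream_prefix v (stream_cat u (phi z))) -> size v <= size u.
Proof.
move=> [x [y xy]] v_pre; rewrite leqNgt; apply/negP => uv; apply: xy.
have v_nth z : nth (phi x 0) v (size u) = phi z 0.
  rewrite (stream_prefix_nth _ (v_pre z))// stream_catE_ge// subnn //.
by rewrite -(v_nth x) -(v_nth y).
Qed.

Lemma longest_common_prefix_complete u phi w : complete_response phi ->
  longest_common_prefix (range (fun z => stream_cat u (phi z))) w <-> w = u.
Proof.
move=> phiC; have u_lcp :
    longest_common_prefix (range (fun z => stream_cat u (phi z))) u.
  split=> [_ [z _ <-]|v v_pre]; first exact: stream_prefix_cat.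
  by apply: (complete_response_leq phiC) => z; apply: v_pre; exists z.
split=> [[w_pre w_max]|-> //]; have wu : size w = size u.
  by apply/eqP; rewrite eqn_leq w_max ?u_lcp.2//; apply: u_lcp.1.
have [x _] := phiC.
have Xx : range (fun z => stream_cat u (phi z)) (stream_cat u (phi x)).
  by exists x.
by rewrite (w_pre _ Xx) {2}(u_lcp.1 _ Xx) wu.
Qed.

End CompleteResponse.

Section Run.
Variables (n : nat) (Q : Type) (d : 'I_n -> Q -> Q).

Lemma run_cat u v q : run d (u ++ v) q = run d v (run d u q).
Proof. by rewrite /run foldl_cat. Qed.

Lemma synchronizing_leq m k :
  m <= k -> synchronizing_at_level d m -> synchronizing_at_level d k.
Proof.
move=> mk sync w wk p q; rewrite -(cat_take_drop (k - m) w) !run_cat.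
by apply: sync; rewrite size_drop wk subKn.
Qed.

End Run.

Section StateMaps.
Variable n : nat.
Implicit Types (T U : transducer n) (u v w : seq 'I_n) (x y : cantor n).

Lemma lamw_cat T u v (q : state T) :
  lamw (u ++ v) q = lamw u q ++ lamw v (run (@pi n T) u q).
Proof. by elim: u q => //= a u IH q; rewrite IH catA. Qed.

Lemma eq_lamw_state_map T U (p : state T) (q : state U) :
  (forall w, lamw w p = lamw w q) -> state_map p = state_map q.
Proof.
move=> pq; apply: funext => x; apply: funext => i; rewrite /state_map.
have -> : [set k | i < size (lamw (stream_take x k) p)] =
          [set k | i < size (lamw (stream_take x k) q)].
  by apply/seteqP; split=> k /=; rewrite pq.
by rewrite pq.
Qed.

Lemma state_map_prefix T (q : state T) x k : productive T ->
  stream_prefix (lamw (stream_take x k) q) (state_map q x).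
Proof.
move=> T_prod.
(* The outputs on prefixes of x extend one another, so letter i is the same whichever length [xget]
   selects in [state_map]. *)
have coh i j : i <= j -> exists w,
    lamw (stream_take x j) q = lamw (stream_take x i) q ++ w.
  by move=> ij; rewrite -(subnKC ij) stream_takeD lamw_cat; eexists.
apply: (@eq_from_nth _ (x 0)) => [|i ik]; first by rewrite size_stream_take.
rewrite nth_stream_take// /state_map; case: xgetP => [j _ /= ij|no_j].
  rewrite (set_nth_default (x 0) (x i) ij).
  by have [/coh[w ->]|/ltnW/coh[w ->]] := leqP k j; rewrite nth_cat ?ik ?ij.
by case: (no_j k).
Qed.

Lemma state_map_unique T (q : state T) x y : productive T ->
  (forall k, stream_prefix (lamw (stream_take x k) q) y) -> y = state_map q x.
Proof.
move=> T_prod y_pre; apply: stream_eq => N; have [k Nk] := T_prod q x N.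
by exists (lamw (stream_take x k) q); split=> //; exact: state_map_prefix.
Qed.

Lemma state_map_cat T (q : state T) w x : productive T ->
  state_map q (stream_cat w x) =
    stream_cat (lamw w q) (state_map (run (@pi n T) w q) x).
Proof.
move=> T_prod; apply/esym/state_map_unique => // k.
have [wk|kw] := leqP (size w) k.
  rewrite -(subnKC wk) stream_takeD stream_take_cat stream_drop_cat lamw_cat.
  by apply/stream_prefix_cat2; exact: state_map_prefix.
rewrite -(@take_stream_take _ _ _ (size w) (ltnW kw)) stream_take_cat.
rewrite -{2}(cat_take_drop k w) lamw_cat stream_cat_catl.
exact: stream_prefix_cat.
Qed.

Lemma state_map_cons T (q : state T) a x : productive T ->
  state_map q (stream_cat [:: a] x) = stream_cat (lam a q) (state_map (pi a q) x).
Proof. by move=> T_prod; rewrite state_map_cat//= cats0. Qed.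

(** M is a complete invariant of such transducers up to strong isomorphism, by [coded_iso] and
    [iso_coded]. Cores of minimal transducers and products of cores are both shown to have this
    form. *)
Record coded T (M : set (cantor n -> cantor n)) : Prop := Coded {
  coded_productive : productive T;
  coded_injective : injective (@state_map n T);
  coded_complete : forall q : state T, complete_response (state_map q);
  coded_range : range (@state_map n T) = M }.

(** On inputs beginning with a, the common map is the output of one step followed by the map of the
    successor; cancellation separates the two. *)
Lemma eq_state_map_step T U (p : state T) (q : state U) a :
  productive T -> productive U ->
  (forall s : state T, complete_response (state_map s)) ->
  (forall s : state U, complete_response (state_map s)) ->
  state_map p = state_map q ->
  lam a p = lam a q /\ state_map (pi a p) = state_map (pi a q).
Proof.
move=> T_prod U_prod TC UC pq; apply: complete_response_cat_inj => // x.
by rewrite -!state_map_cons// pq.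
Qed.

Lemma coded_iso T U M : coded T M -> coded U M -> strongly_isomorphic T U.
Proof.
move=> cT cU.
have /choice[f fP] : forall p : state T, exists q : state U,
    state_map q = state_map p.
  move=> p; have : range (@state_map n T) (state_map p) by exists p.
  by rewrite (coded_range cT) -(coded_range cU) => -[q _ qp]; exists q.
have /choice[g gP] : forall q : state U, exists p : state T,
    state_map p = state_map q.
  move=> q; have : range (@state_map n U) (state_map q) by exists q.
  by rewrite (coded_range cU) -(coded_range cT) => -[p _ pq]; exists p.
exists f; split=> [|a q].
  exists g => q; last by apply: (coded_injective cU); rewrite fP gP.
  by apply: (coded_injective cT); rewrite gP fP.
have [||||<- pi_eq] := eq_state_map_step a _ _ _ _ (esym (fP q)).
- exact: coded_productive cT.
- exact: coded_productive cU.
- exact: coded_complete cT.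
- exact: coded_complete cU.
by split=> //; apply: (coded_injective cU); rewrite fP.
Qed.

Lemma iso_coded T U M : strongly_isomorphic T U -> coded U M -> coded T M.
Proof.
move=> [f [f_bij f_hom]] cU.
have lamw_f w q : lamw w (f q) = lamw w q.
  elim: w q => //= a w IH q.
  by have [pi_f lam_f] := f_hom a q; rewrite lam_f -pi_f IH.
have map_f q : state_map (f q) = state_map q.
  by apply: eq_lamw_state_map => w; rewrite lamw_f.
split.
- move=> q x N; have [k Nk] := coded_productive cU (f q) x N.
  by exists k; rewrite -lamw_f.
- move=> p q; rewrite -!map_f => /(coded_injective cU).
  exact: (bij_inj f_bij).
- by move=> q; rewrite -map_f; exact: coded_complete cU _.
- rewrite -(coded_range cU); apply/seteqP; split=> _ [q _ <-].
    by exists (f q).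
  by have [g _ fK] := f_bij; exists (g q); rewrite // -map_f fK.
Qed.

Lemma restrict_lamw T (P : pred (state T))
    (P_closed : forall a (q : state T), P q -> P (pi a q))
    (q : state (restrict P_closed)) w :
  lamw w q = lamw w (val q).
Proof. by elim: w q => //= a w IH q; rewrite IH. Qed.

Lemma restrict_state_map T (P : pred (state T))
    (P_closed : forall a (q : state T), P q -> P (pi a q))
    (q : state (restrict P_closed)) :
  state_map q = state_map (val q).
Proof. by apply: eq_lamw_state_map => w; rewrite restrict_lamw. Qed.

Lemma restrict_productive T (P : pred (state T))
    (P_closed : forall a (q : state T), P q -> P (pi a q)) :
  productive T -> productive (restrict P_closed).
Proof.
by move=> T_prod q x N; have [k] := T_prod (val q) x N; exists k; rewrite restrict_lamw.
Qed.

End StateMaps.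

(** * Local maps and cores *)

Section LocalMaps.
Variables n r : nat.
Implicit Types (f g : dcantor n r -> dcantor n r) (d e : 'I_r).
Implicit Types (u v w : seq 'I_n) (x y : cantor n) (phi psi : cantor n -> cantor n).

Definition local_map f (nu : dword n r) phi : Prop :=
  complete_response phi /\
  exists mu : dword n r, forall x, f (dcat nu x) = dcat mu (phi x).

Definition suffix_map f w phi : Prop :=
  forall d v, local_map f (d, v ++ w) phi.

Definition synchronizing_map f (m : nat) : Prop :=
  forall w, size w = m -> exists phi, suffix_map f w phi.

Definition core_maps f : set (cantor n -> cantor n) :=
  [set phi | exists w, suffix_map f w phi].

Lemma dcat_cat d v w x : dcat (d, v ++ w) x = dcat (d, v) (stream_cat w x).
Proof. by rewrite /dcat/= stream_cat_catl. Qed.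

Lemma cylinder_dcat d w (y : dcantor n r) :
  cylinder (d, w) y -> y = dcat (d, w) (stream_drop (size w) y.2).
Proof.
by case: y => e y [/= -> /stream_prefix_drop]; rewrite /dcat /= => ->.
Qed.

Lemma dcat_inj (nu : dword n r) : injective (dcat nu).
Proof. by case: nu => d v x y [/stream_cat_inj]. Qed.

Lemma dcat_complete_inj (mu nu : dword n r) phi psi :
  complete_response phi -> complete_response psi ->
  (forall x, dcat mu (phi x) = dcat nu (psi x)) -> mu = nu /\ phi = psi.
Proof.
case: mu nu => d u [e v] phiC psiC eq_cat.
have [x _] := phiC; have [-> _] := eq_cat x.
have [|-> -> //] := @complete_response_cat_inj _ u v _ _ phiC psiC.
by move=> z; have [] := eq_cat z.
Qed.

Lemma local_map_unique f nu phi psi :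
  local_map f nu phi -> local_map f nu psi -> phi = psi.
Proof.
move=> [phiC [mu fmu]] [psiC [mu' fmu']].
by case: (@dcat_complete_inj mu mu' phi psi) => // x; rewrite -fmu fmu'.
Qed.

Lemma suffix_map_cat f v w phi : suffix_map f w phi -> suffix_map f (v ++ w) phi.
Proof. by move=> f_w d u; rewrite catA; exact: f_w. Qed.

Lemma suffix_map_unique f w phi psi : 0 < r ->
  suffix_map f w phi -> suffix_map f w psi -> phi = psi.
Proof.
by move=> r0 f_phi f_psi; apply: (local_map_unique (f_phi (Ordinal r0) [::])).
Qed.

Lemma synchronizing_map_leq f m w : synchronizing_map f m -> m <= size w ->
  exists phi, suffix_map f w phi.
Proof.
move=> f_sync mw.
have [|phi f_phi] := f_sync (drop (size w - m) w); first by rewrite size_drop subKn.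
by exists phi; rewrite -(cat_take_drop (size w - m) w); exact: suffix_map_cat.
Qed.

End LocalMaps.

Section DottedRuns.
Variables n r : nat.
Implicit Types (A : dtransducer n r) (g : dcantor n r -> dcantor n r).

Lemma run_config_step_S (R : Type) (T : transducer n)
    (rstep : 'I_n -> R -> config r R T) w s d u :
  run (config_step rstep) w (inr (s, (d, u))) =
    inr (run (@pi n T) w s, (d, u ++ lamw w s)).
Proof.
elim: w s u => [|a w IH] s u; first by rewrite cats0.
by rewrite -[LHS]/(run _ w _) /= IH -catA.
Qed.

Lemma config_state_run (R : Type) (T : transducer n)
    (rstep : 'I_n -> R -> config r R T) w c :
  config_state (run (config_step rstep) w c) = run (rs_pi rstep) w (config_state c).
Proof.
elim: w c => // a w IH c; rewrite [LHS]IH; congr run.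
by case: c => [//|[s [d u]]].
Qed.

Lemma represents_cat A g d w s mu : represents A g ->
  config_run w (start A d) = inr (s, mu) ->
  forall x, g (dcat (d, w) x) = dcat mu (state_map s x).
Proof.
case: mu => e u Ag run_w x.
have out k : e = (g (dcat (d, w) x)).1 /\
    stream_prefix (u ++ lamw (stream_take x k) s) (g (dcat (d, w) x)).2.
  have := Ag d (stream_cat w x) (size w + k).
  rewrite stream_takeD stream_take_cat stream_drop_cat /config_run run_cat.
  by rewrite -/(config_run w _) run_w run_config_step_S.
have [eg /stream_prefix_catl/stream_prefix_drop g2] := out 0.
rewrite [LHS]surjective_pairing -eg -g2 /dcat/=; congr (_, stream_cat _ _).
apply: state_map_unique => [|k]; first exact: spart_productive.
by apply/(stream_prefix_cat2 u); rewrite g2; have [] := out k.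
Qed.

(** If all values of [state_map s] began with the same letter, appending it to the output on w would
    give a longer common prefix of the image of the cylinder, against minimality. *)
Lemma minimal_local_map A g d w s mu : 0 < n -> minimal_for A g ->
  config_run w (start A d) = inr (s, mu) -> local_map g (d, w) (state_map s).
Proof.
move=> n0 [Ag _ lcp _ _] run_w; have g_w := represents_cat Ag run_w.
split; last by exists mu.
have [_] := lcp d w; rewrite run_w /=; case: mu => e u in run_w g_w * => u_max.
apply: contrapT => nC.
have const x y : state_map s x 0 = state_map s y 0.
  by apply: contrapT => xy; apply: nC; exists x, y.
pose x0 : cantor n := fun=> Ordinal n0.
suff: size (rcons u (state_map s x0 0)) <= size u by rewrite size_rcons ltnn.
apply: (u_max (Some (e, rcons u (state_map s x0 0)))).
move=> _ [y /cylinder_dcat -> <-].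
rewrite g_w /=; split=> //; rewrite -cats1; apply/stream_prefix_cat2.
by congr cons; exact: const.
Qed.

(** The run cannot still be in R: nothing has been output there, whereas a local map provides a
    nonempty common prefix of the image of the cylinder. *)
Lemma minimal_config A g d w phi : minimal_for A g -> local_map g (d, w) phi ->
  0 < n -> exists s mu,
    config_run w (start A d) = inr (s, mu) /\ state_map s = phi.
Proof.
move=> A_min g_phi n0; have [_ _ lcp _ _] := A_min.
case def_c: (config_run w (start A d)) => [q|[s mu]].
  have [_ [[e u] g_w]] := g_phi; have [_] := lcp d w; rewrite def_c /=.
  move/(_ (Some (e, u))); suff pre : forall y, (g @` cylinder (d, w)) y ->
    dprefix (Some (e, u)) y by move/(_ pre).
  move=> _ [y /cylinder_dcat -> <-].
  by rewrite g_w; split=> //; exact: stream_prefix_cat.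
exists s, mu; split=> //.
exact: local_map_unique (minimal_local_map n0 A_min def_c) g_phi.
Qed.

(** Every state is reached by some word d v, so reading w from it amounts to reading d v w, whose
    local map is phi whatever d v is. *)
Lemma minimal_synchronizing A g m w phi : 0 < n -> minimal_for A g ->
  size w = m -> suffix_map g w phi ->
  forall p, exists s,
    run (rs_pi (@rstep n r A)) w p = inr s /\ state_map s = phi.
Proof.
move=> n0 A_min wm g_phi p; have [_ reach _ _ _] := A_min.
have [d [v <-]] := reach p.
have [s [mu [run_vw s_phi]]] := minimal_config A_min (g_phi d v) n0.
exists s; split=> //; rewrite -config_state_run -run_cat.
by rewrite -[run _ _ _]/(config_run _ _) run_vw.
Qed.

Lemma minimal_strongly_synchronizing A g m : 0 < n -> minimal_for A g ->
  synchronizing_map g m -> synchronizing_at_level (rs_pi (@rstep n r A)) m.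
Proof.
move=> n0 A_min g_sync w wm p q; have [phi g_phi] := g_sync w wm.
have [_ _ _ _ inj] := A_min.
have [s [-> s_phi]] := minimal_synchronizing n0 A_min wm g_phi p.
have [t [-> t_phi]] := minimal_synchronizing n0 A_min wm g_phi q.
by congr inr; apply: inj; rewrite s_phi t_phi.
Qed.

Lemma dcore_coded A g m : 0 < n -> 0 < r -> minimal_for A g ->
  synchronizing_map g m -> coded (dcore A) (core_maps g).
Proof.
move=> n0 r0 A_min g_sync; have [Ag reach lcp _ inj] := A_min.
split.
- exact/restrict_productive/spart_productive.
- move=> p q; rewrite !restrict_state_map => /inj; exact: val_inj.
- move=> q; rewrite restrict_state_map; have [d [w]] := reach (inr (val q)).
  case def_c: (config_run w (start A d)) => [//|[s mu]] def_s.
  have -> : val q = s by case: def_s.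
  by have [] := minimal_local_map n0 A_min def_c.
apply/seteqP; split=> [_ [q _ <-]|phi [w g_phi]].
  rewrite restrict_state_map; have /asboolP[k [_ [w [_ run_w]]]] := valP q.
  exists w => d v; have := run_w (config_state (config_run v (start A d))).
  rewrite -config_state_run -run_cat.
  case def_c: (run _ _ _) => [//|[s mu]] def_s.
  have -> : val q = s by case: def_s.
  exact: minimal_local_map n0 A_min def_c.
(* The word w may be too short to synchronize; m arbitrary letters in front make its length a level
   and keep its suffix map. *)
pose v := nseq m (Ordinal n0) ++ w.
have sz_v : m <= size v by rewrite size_cat size_nseq leq_addr.
have {}g_phi : suffix_map g v phi by exact: suffix_map_cat.
have run_v := minimal_synchronizing n0 A_min erefl g_phi.
have [s [run_s s_phi]] := run_v (config_state (start A (Ordinal r0))).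
have s_core : dcore_pred s.
  apply/asboolP; exists (size v); split.
    apply: (synchronizing_leq sz_v).
    exact: (minimal_strongly_synchronizing n0 A_min).
  exists v; split=> // p; have [t [-> t_phi]] := run_v p.
  by congr inr; apply: inj; rewrite s_phi.
by exists (exist _ s s_core) => //; rewrite restrict_state_map.
Qed.

Lemma represents_synchronizing_map A g : 1 < n -> 0 < r -> injective g ->
  strongly_synchronizing A -> represents A g -> exists m, synchronizing_map g m.
Proof.
(* Level m + 1 keeps w nonempty: if w led to a state q of R, then reading w from q would return to
   q, against acyclicity. *)
move=> n1 r0 g_inj [m sync] Ag; exists m.+1 => w wm.
have {}sync := synchronizing_leq (leqnSn m) sync.
pose p0 := config_state (start A (Ordinal r0)).
case def_s: (run (rs_pi (@rstep n r A)) w p0) => [q|s].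
  have w_neq0 : w != [::] by case: (w) wm.
  by case: (@rstate_acyclic _ _ A q w w_neq0); rewrite -[RHS]def_s; exact: sync.
have conf d v : exists mu, config_run (v ++ w) (start A d) = inr (s, mu).
  have : config_state (config_run (v ++ w) (start A d)) = inr s.
    rewrite -def_s /config_run run_cat config_state_run; exact: sync.
  by case: config_run => [//|[t mu]] [->]; exists mu.
have s_inj : injective (state_map s).
  move=> x y s_xy; have [mu run_w] := conf (Ordinal r0) [::].
  apply: (@dcat_inj _ _ (Ordinal r0, w)); apply: g_inj.
  by rewrite !(represents_cat Ag run_w) s_xy.
(* As A need not be minimal, s may have incomplete response; its common prefix u is moved into the
   output on the word read before. *)
have [u [phi [phiC s_phi]]] := injective_factor n1 s_inj.
exists phi => d v; split=> //; have [[e v'] run_w] := conf d v.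
by exists (e, v' ++ u) => z; rewrite (represents_cat Ag run_w) s_phi dcat_cat.
Qed.

End DottedRuns.

(** * Minimal transducers *)

Section PrefixContinuity.
Variables n r : nat.

Definition agree k (y z : dcantor n r) : Prop :=
  y.1 = z.1 /\ stream_take y.2 k = stream_take z.2 k.

(** Topological continuity in terms of finite prefixes; see [continuousE]. *)
Definition prefix_continuous (f : dcantor n r -> dcantor n r) : Prop :=
  forall y N, exists k, forall z, agree k y z -> agree N (f y) (f z).

Definition stream_continuous (phi : cantor n -> cantor n) : Prop :=
  forall x N, exists k, forall y, stream_take x k = stream_take y k ->
    stream_take (phi x) N = stream_take (phi y) N.

Lemma local_map_continuous f nu phi :
  prefix_continuous f -> local_map f nu phi -> stream_continuous phi.
Proof.
case: nu => d v f_cont [_ [[e u] f_phi]] x N.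
have [k k_agree] := f_cont (dcat (d, v) x) (size u + N).
exists k => y xy; have [|_] := k_agree (dcat (d, v) y).
  split=> //=; apply/stream_take_eq => i ik; have [iv|vi] := ltnP i (size v).
    by rewrite !(stream_catE_lt (x 0)).
  by rewrite !stream_catE_ge//; move/stream_take_eq : xy; apply; lia.
rewrite !f_phi /= !stream_takeD !stream_take_cat !stream_drop_cat.
by move/(congr1 (drop (size u))); rewrite !drop_size_cat.
Qed.

End PrefixContinuity.

(** The elements of M serve as states. Productivity comes from continuity: if a prefix that
    determines N letters of the value produced fewer than N letters, the state reached would have a
    forced first letter, against complete response. *)
Lemma coded_exists n (M : set (cantor n -> cantor n)) :
  (forall phi, M phi -> complete_response phi) ->
  (forall phi, M phi -> stream_continuous phi) ->
  (forall phi a, M phi -> exists u psi, M psi /\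
    forall x, phi (stream_cat [:: a] x) = stream_cat u (psi x)) ->
  exists T : transducer n, coded T M.
Proof.
move=> M_complete M_cont M_step.
pose S : choiceType := {phi : cantor n -> cantor n | `[< M phi >]}.
have MS (s : S) : M (val s) by have /asboolP := valP s.
have /choice[F FP] : forall p : 'I_n * S, exists q : seq 'I_n * S, forall x,
    val p.2 (stream_cat [:: p.1] x) = stream_cat q.1 (val q.2 x).
  move=> [a s]; have [u [psi [/asboolP Mpsi s_psi]]] := M_step _ a (MS s).
  by exists (u, exist _ psi Mpsi).
pose T := @Transducer n S (fun a s => (F (a, s)).2) (fun a s => (F (a, s)).1).
exists T.
have T_cat w (s : state T) x : val s (stream_cat w x) =
    stream_cat (lamw w s) (val (run (@pi n T) w s) x).
  elim: w s => [|a w IH] s; first by rewrite !stream_cat0.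
  by rewrite -cat1s stream_cat_catl (FP (a, s)) IH -stream_cat_catl.
have T_prod : productive T.
  move=> s x N; have [k kN] := M_cont _ (MS s) x N; exists k.
  rewrite leqNgt; apply/negP => ltN.
  have [y [z]] := M_complete _ (MS (run (@pi n T) (stream_take x k) s)).
  apply; set t := run _ _ _.
  have tE y' : val t y' 0 = val s x (size (lamw (stream_take x k) s)).
    have /stream_take_eq/(_ _ ltN) -> : stream_take (val s x) N =
        stream_take (val s (stream_cat (stream_take x k) y')) N.
      apply: kN; rewrite -[X in _ = stream_take _ X](size_stream_take x k).
      by rewrite stream_take_cat.
    by rewrite T_cat stream_catE_ge// subnn.
  by rewrite !tE.
have T_map (s : state T) : state_map s = val s.
  apply: funext => x; apply/esym/state_map_unique => // k.
  by rewrite -{2}(stream_take_drop k x) T_cat; exact: stream_prefix_cat.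
split=> //.
- by move=> s t; rewrite !T_map; exact: val_inj.
- by move=> s; rewrite T_map; exact/M_complete/MS.
apply/seteqP; split=> [_ [s _ <-]|phi /[dup] Mphi /asboolP phiM].
  by rewrite T_map; exact: MS.
by exists (exist _ phi phiM); rewrite // T_map.
Qed.

Section MinimalTransducer.
Variables (n r : nat) (g : dcantor n r -> dcantor n r) (m : nat).
Hypotheses (n1 : 1 < n) (g_inj : injective g) (g_cont : prefix_continuous g).
Hypothesis g_sync : synchronizing_map g m.

Definition local_maps : set (cantor n -> cantor n) :=
  [set phi | exists nu, local_map g nu phi].

(* Restrictions of [g] to cylinders whose image meets several dotted letters:
   these are the states on which no output can be produced yet. *)
Definition branching (psi : cantor n -> dcantor n r) : Prop :=
  exists x y, (psi x).1 <> (psi y).1.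

Lemma local_map_not_branching nu phi :
  local_map g nu phi -> ~ branching (g \o dcat nu).
Proof. by move=> [_ [mu g_nu]] [x [y]]; rewrite /= !g_nu. Qed.

Lemma not_branching_local_map nu :
  ~ branching (g \o dcat nu) -> exists phi, local_map g nu phi.
Proof.
move=> nb; pose x0 : cantor n := fun=> Ordinal (ltnW n1).
have e_const x : (g (dcat nu x)).1 = (g (dcat nu x0)).1.
  by apply: contrapT => xx0; apply: nb; exists x, x0.
have [x y xy|u [phi [phiC g_phi]]] :=
    @injective_factor n (fun x => (g (dcat nu x)).2) n1.
  apply: (@dcat_inj _ _ nu); apply: g_inj.
  by rewrite [LHS]surjective_pairing [RHS]surjective_pairing xy !e_const.
exists phi; split=> //; exists ((g (dcat nu x0)).1, u) => x.
by rewrite [LHS]surjective_pairing e_const g_phi.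
Qed.

(** This bound on the depth of R yields both its finiteness and the absence of loops. *)
Lemma branching_size d w : branching (g \o dcat (d, w)) -> size w < m.
Proof.
move=> b; rewrite ltnNge; apply/negP => mw.
have [phi g_phi] := synchronizing_map_leq g_sync mw.
exact: local_map_not_branching (g_phi d [::]) b.
Qed.

(** A word longer than m has the local map of its last m letters read after the same dotted letter,
    so words of length at most m give all local maps. The default of [xget] only enlarges the finite
    range. *)
Lemma local_maps_finite : finite_set local_maps.
Proof.
pose F (nu : 'I_r * m.-bseq 'I_n) : cantor n -> cantor n :=
  xget (id : cantor n -> cantor n) [set phi | local_map g (nu.1, val nu.2) phi].
apply: (@sub_finite_set _ _ (range F)); last exact/finite_image/finite_finset.
move=> phi [[d w] g_phi].
have [w' [w'm g_w']] : exists w', size w' <= m /\ local_map g (d, w') phi.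
  have [|/ltnW mw] := leqP (size w) m; first by exists w.
  exists (drop (size w - m) w); rewrite size_drop subKn//; split=> //.
  have [|psi g_psi] := @g_sync (drop (size w - m) w).
    by rewrite size_drop subKn.
  have := g_psi d (take (size w - m) w); rewrite cat_take_drop.
  by move/(local_map_unique g_phi) ->; exact: (g_psi d [::]).
exists (d, Bseq w'm) => //; rewrite /F; case: xgetP => [psi _ /= g_psi|no].
  exact: local_map_unique g_psi g_w'.
by case: (no phi).
Qed.

Definition branching_seq : seq (cantor n -> dcantor n r) :=
  [seq psi <- [seq g \o dcat (nu.1, val nu.2) | nu <- enum {: 'I_r * m.-bseq 'I_n}] |
     `[< branching psi >]].

Lemma branching_seqP psi : psi \in branching_seq <->
  exists nu, psi = g \o dcat nu /\ branching psi.
Proof.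
rewrite mem_filter; split=> [/andP[/asboolP b /mapP[nu _ psiE]]|].
  by exists (nu.1, val nu.2).
move=> [[d w] [psiE b]]; apply/andP; split; first exact/asboolP.
rewrite psiE in b *; have wm := ltnW (branching_size b).
by apply/mapP; exists (d, Bseq wm) => //; rewrite mem_enum.
Qed.

Lemma coded_local_maps : exists T : transducer n, coded T local_maps.
Proof.
apply: coded_exists => [phi [nu []]//|phi [nu g_phi]|phi a [[d v] g_phi]].
  exact: local_map_continuous g_cont g_phi.
have [x y xy|u [psi [psiC phi_psi]]] :=
    @injective_factor n (fun x => phi (stream_cat [:: a] x)) n1.
  have [_ [mu g_nu]] := g_phi.
  apply: (@stream_cat_inj _ [:: a]); apply: (@dcat_inj _ _ (d, v)).
  by apply: g_inj; rewrite !g_nu xy.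
exists u, psi; split=> //; exists (d, v ++ [:: a]); split=> //.
have [_ [[e v'] g_nu]] := g_phi.
by exists (e, v' ++ u) => x; rewrite !dcat_cat g_nu phi_psi.
Qed.

Section Construction.
Variable T : transducer n.
Hypothesis cT : coded T local_maps.

Let R : finType := seq_sub branching_seq.

Definition config_spec (psi : cantor n -> dcantor n r) (c : config r R T) : Prop :=
  match c with
  | inl q => val q = psi
  | inr (s, mu) => forall x, psi x = dcat mu (state_map s x)
  end.

Lemma config_spec_exists nu : exists c, config_spec (g \o dcat nu) c.
Proof.
have [b|/not_branching_local_map[phi g_phi]] := pselect (branching (g \o dcat nu)).
  have bs : g \o dcat nu \in branching_seq by apply/branching_seqP; exists nu.
  by exists (inl (SeqSub bs)).
have : range (@state_map n T) phi by rewrite (coded_range cT); exists nu.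
move=> [s _ s_phi]; have [_ [mu g_mu]] := g_phi.
by exists (inr (s, mu)) => x; rewrite s_phi -g_mu.
Qed.

Variables (start0 : 'I_r -> config r R T) (rstep0 : 'I_n -> R -> config r R T).
Hypothesis start_spec : forall d, config_spec (g \o dcat (d, [::])) (start0 d).
Hypothesis rstep_spec : forall a q,
  config_spec (val q \o stream_cat [:: a]) (rstep0 a q).

Lemma config_spec_run psi c w : config_spec psi c ->
  config_spec (psi \o stream_cat w) (run (config_step rstep0) w c).
Proof.
elim: w psi c => [|a w IH] psi c psi_c.
  by rewrite (_ : _ \o _ = psi)//; apply: funext => x; rewrite /= stream_cat0.
rewrite (_ : _ \o _ = (psi \o stream_cat [:: a]) \o stream_cat w); last first.
  by apply: funext => x; rewrite /= -stream_cat_catl.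
apply: IH; case: c psi_c => [q <-|[s [d u]] psi_s x]; first exact: rstep_spec.
rewrite /= psi_s /= state_map_cons; last exact: coded_productive cT.
by rewrite dcat_cat.
Qed.

Lemma config_spec_start d w :
  config_spec (g \o dcat (d, w)) (run (config_step rstep0) w (start0 d)).
Proof.
rewrite (_ : _ \o _ = (g \o dcat (d, [::])) \o stream_cat w).
  exact: config_spec_run.
by apply: funext => x; rewrite /= -dcat_cat.
Qed.

Lemma branching_state (q : R) : exists nu, val q = g \o dcat nu /\ branching (val q).
Proof. by have /branching_seqP[nu [qE b]] := valP q; exists nu. Qed.

Lemma config_spec_leq (q : R) w c : m <= size w ->
  config_spec (val q \o stream_cat w) c -> exists s mu, c = inr (s, mu).
Proof.
move=> mw; case: c => [p p_q|[s mu]]; last by exists s, mu.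
have [[d v] [q_v _]] := branching_state q; have [_ [_ p_b]] := branching_state p.
have : branching (g \o dcat (d, v ++ w)).
  rewrite (_ : _ \o _ = val p)// p_q q_v.
  by apply: funext => x; rewrite /= dcat_cat.
by move/branching_size; rewrite size_cat; lia.
Qed.

(** Repeating a loop m times would give a word of length at least m that stays at q, whereas words
    of this length lead into S. *)
Lemma rstep_acyclic (q : R) w : w != [::] ->
  run (rs_pi rstep0) w (inl q) <> inl q.
Proof.
move=> w0 loop.
have loop_run : run (config_step rstep0) w (inl q) = inl q.
  have : config_state (run (config_step rstep0) w (inl q)) = inl q.
    by rewrite config_state_run.
  by case: (run _ _ _) => [p [->]|[s mu]].
have loop_iter k : run (config_step rstep0) (iter k (cat w) [::]) (inl q) = inl q.
  by elim: k => // k IH; rewrite iterS run_cat loop_run.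
have sz_iter k : k <= size (iter k (cat w) [::]).
  elim: k => // k IH; rewrite iterS size_cat.
  by move: w0; rewrite -size_eq0; lia.
have := @config_spec_run (val q) (inl q) (iter m (cat w) [::]) erefl.
by move/(config_spec_leq (sz_iter m)); rewrite loop_iter => -[s [mu]].
Qed.

Lemma local_map_run d w s mu : run (config_step rstep0) w (start0 d) = inr (s, mu) ->
  local_map g (d, w) (state_map s).
Proof.
move=> run_w; split; first exact: coded_complete cT s.
by exists mu => x; have := config_spec_start d w; rewrite run_w => /(_ x).
Qed.

Lemma branching_run d w q : run (config_step rstep0) w (start0 d) = inl q ->
  branching (g \o dcat (d, w)).
Proof.
move=> run_w; have := config_spec_start d w; rewrite run_w /= => <-.
by have [nu [_ q_b]] := branching_state q.
Qed.

Lemma minimal_for_construction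
    (T_countable : countable [set: state T]) (T_prod : productive T) :
  minimal_for (DTransducer start0 T_countable rstep_acyclic T_prod) g.
Proof.
set A := DTransducer _ _ _ _.
have out psi c x : config_spec psi c -> outputs (A := A) c x (psi x).
  move=> psi_c k; have := config_spec_run (stream_take x k) psi_c.
  rewrite /config_run /=; case: (run _ _ _) => [//|[s [e u]]] /= /(_ (stream_drop k x)).
  by rewrite /= stream_take_drop => ->; split=> //=; exact: stream_prefix_cat.
(* After m letters the run is in S, where productivity pins down y; hence distinct states of R have
   distinct outputs. *)
have out_unique (q : R) x y : outputs (A := A) (inl q) x y -> y = val q x.
  move=> q_out; have q_spec w : config_spec (val q \o stream_cat w)
      (run (config_step rstep0) w (inl q)) by exact: config_spec_run.
  have [|s [[e u] run_s]] := config_spec_leq _ (q_spec (stream_take x m)).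
    by rewrite size_stream_take.
  have out_m k : e = y.1 /\
      stream_prefix (u ++ lamw (stream_take (stream_drop m x) k) s) y.2.
    have := q_out (m + k); rewrite stream_takeD /config_run run_cat.
    by rewrite [run _ (stream_take x m) _]run_s run_config_step_S.
  have [ey /stream_prefix_catl/stream_prefix_drop y2] := out_m 0.
  have := q_spec (stream_take x m); rewrite run_s => /(_ (stream_drop m x)).
  rewrite /= stream_take_drop => ->; rewrite [LHS]surjective_pairing -ey -y2.
  congr (_, stream_cat _ _); apply: state_map_unique => // k.
  by apply/(stream_prefix_cat2 u); rewrite y2; have [] := out_m k.
split.
- move=> c x; have := out (g \o dcat (c, [::])) (start0 c) x (start_spec c).
  by rewrite /= /dcat/= stream_cat0.
- case=> [q|s].
    have [[d w] [q_w q_b]] := branching_state q; exists d, w.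
    have := config_spec_start d w; rewrite /config_run /=.
    case def_c: (run _ _ _) => [p|[s mu]] /=; first by rewrite -q_w => /val_inj ->.
    have /local_map_not_branching := local_map_run def_c.
    by rewrite -q_w.
  have : local_maps (state_map s) by rewrite -(coded_range cT); exists s.
  move=> [[d w] g_s]; exists d, w; rewrite /config_run /=.
  case def_c: (run _ _ _) => [q|[t mu]] /=.
    by case: (local_map_not_branching g_s); exact: branching_run def_c.
  congr inr; apply: (coded_injective cT).
  exact: local_map_unique (local_map_run def_c) g_s.
- move=> d w; have dcat_cyl x : (g @` cylinder (d, w)) (g (dcat (d, w) x)).
    by exists (dcat (d, w) x) => //; split=> //=; exact: stream_prefix_cat.
  have := config_spec_start d w; rewrite /config_run /=.
  case def_c: (run _ _ _) => [q|[s [e u]]] /= spec_c; split=> //.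
  (* Two images with different dotted letters exclude every nonempty common prefix. *)
  + move=> [[e u]|//] pre; have [x [y []]] := branching_run def_c.
    by have [<- _] := pre _ (dcat_cyl x); have [<- _] := pre _ (dcat_cyl y).
  + move=> _ [y /cylinder_dcat -> <-]; rewrite spec_c; split=> //.
    exact: stream_prefix_cat.
  + move=> [[e' v]|//] pre; rewrite ltnS.
    apply: (complete_response_leq (coded_complete cT s)) => z.
    by have [_] := pre _ (dcat_cyl z); rewrite [g _]spec_c.
- move=> p q pq; apply: val_inj; apply: funext => x.
  by apply: out_unique; apply/pq; exact: out.
exact: coded_injective cT.
Qed.

End Construction.

Lemma coded_finite T : coded T local_maps -> finite_set [set: state T].
Proof.
move=> cT; rewrite (_ : setT = @state_map n T @^-1` local_maps); last first.
  apply/seteqP; split=> // s _ /=; rewrite -(coded_range cT); by exists s.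
apply: finite_preimage; last exact: local_maps_finite.
by move=> s t _ _ /(coded_injective cT).
Qed.

Lemma minimal_exists : exists A, minimal_for A g /\ finite_dtransducer A.
Proof.
have [T cT] := coded_local_maps; have T_fin := coded_finite cT.
have /choice[start0 start_spec] : forall d,
    exists c : config r (seq_sub branching_seq) T,
    config_spec (g \o dcat (d, [::])) c.
  by move=> d; exact: config_spec_exists.
have /choice[rstep0 rstep_spec] : forall p : 'I_n * seq_sub branching_seq,
    exists c : config r (seq_sub branching_seq) T,
    config_spec (val p.2 \o stream_cat [:: p.1]) c.
  move=> [a q]; have [[d w] [q_w _]] := branching_state q.
  have [c c_spec] := config_spec_exists cT (d, w ++ [:: a]); exists c.
  have qa_w : g \o dcat (d, w ++ [:: a]) = val q \o stream_cat [:: a].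
    by rewrite q_w; apply: funext => x; rewrite [LHS]/= dcat_cat.
  by rewrite qa_w in c_spec.
exists (DTransducer start0 (finite_set_countable T_fin)
  (@rstep_acyclic T cT (fun a q => rstep0 (a, q)) (fun a q => rstep_spec (a, q)))
  (coded_productive cT)).
split=> //; exact: minimal_for_construction.
Qed.

End MinimalTransducer.

(** * Products of cores *)

Section FullProduct.
Variables (n : nat) (T U : transducer n).

Lemma full_product_run w (p : state T) (q : state U) :
  run (@pi n (full_product T U)) w (p, q) =
    (run (@pi n T) w p, run (@pi n U) (lamw w p) q).
Proof.
elim: w p q => // a w IH p q.
by rewrite -[LHS]/(run _ w (_, _)) IH /= run_cat.
Qed.

Lemma full_product_lamw w (p : state T) (q : state U) :
  @lamw n (full_product T U) w (p, q) = lamw (lamw w p) q.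
Proof. by elim: w p q => //= a w IH p q; rewrite IH lamw_cat. Qed.

Lemma full_product_stream (p : state T) (q : state U) x k : productive T ->
  @lamw n (full_product T U) (stream_take x k) (p, q) =
    lamw (stream_take (state_map p x) (size (lamw (stream_take x k) p))) q.
Proof. by move=> /state_map_prefix T_prod; rewrite full_product_lamw -T_prod. Qed.

Lemma full_productive : productive T -> productive U -> productive (full_product T U).
Proof.
move=> T_prod U_prod [p q] x N; have [j Nj] := U_prod q (state_map p x) N.
have [k jk] := T_prod p x j; exists k; apply: leq_trans Nj _.
rewrite full_product_stream// -(subnKC jk) stream_takeD lamw_cat size_cat.
exact: leq_addr.
Qed.

Lemma full_product_state_map (p : state T) (q : state U) :
  productive T -> productive U ->
  @state_map n (full_product T U) (p, q) = state_map q \o state_map p.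
Proof.
move=> T_prod U_prod; apply: funext => x; apply/esym/state_map_unique => [|k].
  exact: full_productive.
rewrite full_product_stream//; exact: state_map_prefix.
Qed.

End FullProduct.

Section RemoveIncompleteResponse.
Variables (n : nat) (T : transducer n).
Hypothesis T_prod : productive T.
Hypothesis T_inj : forall q : state T, injective (state_map q).
Hypothesis n1 : 1 < n.
Local Notation T' := (remove_incomplete_response T).

Lemma state_map_factor (q : state T) : exists phi, complete_response phi /\
  forall x, state_map q x = stream_cat (image_prefix q) (phi x).
Proof.
have [u [phi [phiC q_phi]]] := injective_factor n1 (T_inj (q := q)).
exists phi; split=> // x; rewrite q_phi; congr stream_cat.
rewrite /image_prefix (_ : state_map q = fun x => stream_cat u (phi x)); last first.
  exact: funext.
case: xgetP => [w _ /=|/(_ u)]; first by move/(longest_common_prefix_complete _ _ phiC).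
by case; exact/(longest_common_prefix_complete _ _ phiC).
Qed.

(** The [drop] removes a genuine prefix: the word on the right is the longest common prefix of the
    values at inputs beginning with a, and [image_prefix q] is common to all values. *)
Lemma remove_incomplete_response_step a (q : state T) :
  image_prefix q ++ @lam n T' a q = lam a q ++ image_prefix (pi a q).
Proof.
have [phi [phiC q_phi]] := state_map_factor q.
have [psi [psiC aq_psi]] := state_map_factor (pi a q).
have aq x : stream_cat (lam a q ++ image_prefix (pi a q)) (psi x) =
    stream_cat (image_prefix q) (phi (stream_cat [:: a] x)).
  by rewrite -q_phi state_map_cons// aq_psi stream_cat_catl.
have [x _] := psiC.
have [|||w def_w] := @stream_prefix_leq _ (image_prefix q)
    (lam a q ++ image_prefix (pi a q))
    (stream_cat (image_prefix q) (phi (stream_cat [:: a] x))).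
- exact: stream_prefix_cat.
- by rewrite -aq; exact: stream_prefix_cat.
- apply: (complete_response_leq psiC) => z; rewrite aq; exact: stream_prefix_cat.
by rewrite /= def_w drop_size_cat.
Qed.

Lemma remove_incomplete_response_lamw w (q : state T) :
  image_prefix q ++ @lamw n T' w q =
    lamw w q ++ image_prefix (run (@pi n T) w q).
Proof.
elim: w q => [|a w IH] q; first by rewrite cats0.
rewrite [lamw _ _ in LHS]/= catA remove_incomplete_response_step -catA IH.
by rewrite catA.
Qed.

Lemma remove_incomplete_response_productive : productive T'.
Proof.
move=> q x N; have [k Nk] := T_prod q x (size (@image_prefix n T q) + N).
exists k; rewrite -(leq_add2l (size (@image_prefix n T q))) -size_cat.
rewrite remove_incomplete_response_lamw size_cat.
by apply: leq_trans Nk _; exact: leq_addr.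
Qed.

Lemma remove_incomplete_response_state_map (q : state T) x :
  state_map q x = stream_cat (image_prefix q) (@state_map n T' q x).
Proof.
have [phi [phiC q_phi]] := state_map_factor q; rewrite q_phi; congr stream_cat.
apply: state_map_unique => [|k]; first exact: remove_incomplete_response_productive.
apply/(stream_prefix_cat2 (image_prefix q)).
rewrite remove_incomplete_response_lamw -q_phi -(stream_take_drop k x).
rewrite state_map_cat// stream_take_drop.
have [psi [_ ->]] := state_map_factor (run (@pi n T) (stream_take x k) q).
by rewrite -stream_cat_catl; exact: stream_prefix_cat.
Qed.

Lemma remove_incomplete_response_complete (q : state T) :
  complete_response (@state_map n T' q).
Proof.
have [phi [phiC q_phi]] := state_map_factor q.
suff -> : @state_map n T' q = phi by [].
apply: funext => x; apply: (@stream_cat_inj _ (image_prefix q)).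
by rewrite -remove_incomplete_response_state_map q_phi.
Qed.

End RemoveIncompleteResponse.

Lemma identify_states_coded n (T : transducer n) : productive T ->
  (forall q : state T, complete_response (state_map q)) ->
  coded (identify_states T) (range (@state_map n T)).
Proof.
move=> T_prod TC.
have reprE (q : state T) : state_map
    (repr (\pi_({eq_quot (same_map_equiv T)})%qT q)) = state_map q.
  by have /eqmodP/asboolP := reprK (\pi_({eq_quot (same_map_equiv T)})%qT q).
(* The induction ranges over all q with the map of [repr Q], because after one letter the
   representative of the new class may differ from the successor of [repr Q]. *)
have lamwE w (Q : state (identify_states T)) (q : state T) :
    state_map (repr Q) = state_map q -> lamw w Q = lamw w q.
  elim: w Q q => //= a w IH Q q Qq.
  have [-> pi_Qq] := eq_state_map_step a T_prod T_prod TC TC Qq.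
  by congr cat; apply: IH; rewrite reprE.
have mapE (Q : state (identify_states T)) : state_map Q = state_map (repr Q).
  by apply: eq_lamw_state_map => w; exact: lamwE.
split.
- move=> Q x N; have [k Nk] := T_prod (repr Q) x N.
  by exists k; rewrite (lamwE _ _ (repr Q)).
- move=> P Q; rewrite !mapE => PQ; rewrite -[P]reprK -[Q]reprK.
  by apply/eqmodP/asboolP.
- by move=> Q; rewrite mapE.
apply/seteqP; split=> [_ [Q _ <-]|_ [q _ <-]]; first by exists (repr Q).
by exists (\pi_({eq_quot (same_map_equiv T)})%qT q); rewrite // mapE reprE.
Qed.

Section CodedCore.
Variables (n r : nat) (f : dcantor n r -> dcantor n r) (T : transducer n).
Hypotheses (r0 : 0 < r) (cT : coded T (core_maps f)).

Lemma state_map_run d v e u (p : state T) w :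
  (forall x, f (dcat (d, v) x) = dcat (e, u) (state_map p x)) ->
  forall x, f (dcat (d, v ++ w) x) =
    dcat (e, u ++ lamw w p) (state_map (run (@pi n T) w p) x).
Proof.
move=> f_p x; rewrite dcat_cat f_p state_map_cat ?dcat_cat//.
exact: coded_productive cT.
Qed.

Lemma coded_core_map (p : state T) : exists w, suffix_map f w (state_map p).
Proof.
have : range (@state_map n T) (state_map p) by exists p.
by rewrite (coded_range cT).
Qed.

Lemma coded_state w phi : suffix_map f w phi -> exists p : state T, state_map p = phi.
Proof.
move=> f_w; have : core_maps f phi by exists w.
by rewrite -(coded_range cT) => -[p _ <-]; exists p.
Qed.

(** The map of p is the suffix map of some w0, so the state reached carries the local map at w0 w,
    and this is phi because w0 w ends in w. *)
Lemma coded_run w phi (p : state T) :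
  suffix_map f w phi -> state_map (run (@pi n T) w p) = phi.
Proof.
move=> f_w; have [w0 f_p] := coded_core_map p.
have [_ [[e u] f_p0]] := f_p (Ordinal r0) [::].
apply: (local_map_unique _ (f_w (Ordinal r0) w0)); split.
  exact: coded_complete cT _.
by exists (e, u ++ lamw w p); exact: state_map_run.
Qed.

Lemma coded_state_injective (p : state T) : injective f -> injective (state_map p).
Proof.
move=> f_inj x y xy; have [w f_p] := coded_core_map p.
have [_ [mu f_p0]] := f_p (Ordinal r0) [::].
by apply: (@dcat_inj _ _ (Ordinal r0, w)); apply: f_inj; rewrite !f_p0 xy.
Qed.

(** After m letters the state no longer depends on p, which makes productivity along a fixed input
    uniform in p; the fan theorem then makes it uniform in the input. *)
Lemma coded_growth m k : synchronizing_map f m ->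
  exists K, forall w, K <= size w -> forall p : state T, k <= size (lamw w p).
Proof.
move=> f_sync; apply: fan_theorem => [u v u_k p|x].
  by rewrite lamw_cat size_cat; apply: leq_trans (u_k p) _; exact: leq_addr.
have [phi f_phi] := f_sync _ (size_stream_take x m).
have [t t_phi] := coded_state f_phi.
have [j kj] := coded_productive cT t (stream_drop m x) k; exists (m + j) => p.
rewrite stream_takeD lamw_cat size_cat; apply: leq_trans kj _.
suff -> : run (@pi n T) (stream_take x m) p = t by exact: leq_addl.
by apply: (coded_injective cT); rewrite t_phi; exact: coded_run.
Qed.

End CodedCore.

Section Product.
Variables (n r : nat) (f g : dcantor n r -> dcantor n r) (T U : transducer n).
Variables mf mg : nat.
Hypotheses (n1 : 1 < n) (r0 : 0 < r).
Hypotheses (f_inj : injective f) (g_inj : injective g).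
Hypotheses (f_sync : synchronizing_map f mf) (g_sync : synchronizing_map g mg).
Hypotheses (cT : coded T (core_maps f)) (cU : coded U (core_maps g)).

Local Notation P := (full_product T U).
Local Notation P' := (remove_incomplete_response P).

Lemma product_state_map_injective (s : state P) : injective (state_map s).
Proof.
case: s => p q x y; rewrite full_product_state_map.
- by move/(coded_state_injective r0 cU g_inj)/(coded_state_injective r0 cT f_inj).
- exact: coded_productive cT.
- exact: coded_productive cU.
Qed.

Lemma product_productive : productive P.
Proof. exact: full_productive (coded_productive cT) (coded_productive cU). Qed.

Lemma product_level : exists N, forall w, N <= size w ->
  exists s : state P', (forall s0, run (@pi n P') w s0 = s) /\
    suffix_map (f \; g) w (state_map s).
Proof.
have [K K_mg] := coded_growth r0 cT mg f_sync.
(* The first mf letters synchronize T; the remaining ones, at least K, make it output at least mg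
   letters, which synchronize U. *)
exists (mf + K) => w Nw.
pose w1 := take mf w; pose w2 := drop mf w.
have w12 : w = w1 ++ w2 by rewrite cat_take_drop.
have w1_mf : size w1 = mf by rewrite size_take; case: ltngtP Nw => //; lia.
have w2_K : K <= size w2 by rewrite size_drop; lia.
have [phi f_phi] := f_sync w1_mf.
have [p1 p1_phi] := coded_state cT f_phi.
have run_w1 p : run (@pi n T) w1 p = p1.
  by apply: (coded_injective cT); rewrite p1_phi; exact: coded_run f_phi.
have [psi g_psi] := synchronizing_map_leq g_sync (K_mg _ w2_K p1).
have [q2 q2_psi] := coded_state cU g_psi.
have run_w2 q : run (@pi n U) (lamw w2 p1) q = q2.
  by apply: (coded_injective cU); rewrite q2_psi; exact: coded_run g_psi.
exists (run (@pi n T) w2 p1, q2); split=> [[p q]|d v].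
  by rewrite [LHS]full_product_run w12 run_cat lamw_cat run_cat run_w1 run_w2.
split.
  exact: remove_incomplete_response_complete product_productive
    product_state_map_injective n1 _.
have [_ [[e u] f_w1]] := f_phi d v.
have f_w x : f (dcat (d, v ++ w) x) =
    dcat (e, u ++ lamw w2 p1) (state_map (run (@pi n T) w2 p1) x).
  rewrite w12 catA; apply: (state_map_run cT) => y.
  by rewrite f_w1 p1_phi.
have [_ [[e' u'] g_w]] := g_psi e u.
(* The prefix deleted from the state map by removing incomplete response reappears in the output. *)
exists (e', u' ++ @image_prefix n P (run (@pi n T) w2 p1, q2)) => x.
rewrite /= f_w g_w -q2_psi dcat_cat; congr dcat.
rewrite -(remove_incomplete_response_state_map product_productive
  product_state_map_injective n1).
rewrite full_product_state_map //; first exact: coded_productive cT.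
exact: coded_productive cU.
Qed.

Lemma product_synchronizing : exists N, synchronizing_map (f \; g) N.
Proof.
have [N PN] := product_level; exists N => w wN.
by have [|s [_]] := PN w; [rewrite wN|exists (state_map s)].
Qed.

Lemma tmul_coded : coded (tmul T U) (core_maps (f \; g)).
Proof.
have P'_prod := remove_incomplete_response_productive product_productive
  product_state_map_injective n1.
have P'C := remove_incomplete_response_complete product_productive
  product_state_map_injective n1.
suff <- : range (@state_map n (core P')) = core_maps (f \; g).
  apply: identify_states_coded; first exact: restrict_productive.
  by move=> q; rewrite restrict_state_map; exact: P'C.
(* The words that witness a core state or a core map may be shorter than N; letters put in front
   change neither the state reached nor the suffix map. *)
have [N PN] := product_level; pose pad := nseq N (Ordinal (ltnW n1)).
have N_pad w : N <= size (pad ++ w) by rewrite size_cat size_nseq leq_addr.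
apply/seteqP; split=> [_ [s _ <-]|phi [w fg_phi]].
  rewrite restrict_state_map; have /asboolP[k [_ [w [_ run_w]]]] := valP s.
  have [t [run_pad fg_t]] := PN _ (N_pad w); exists (pad ++ w).
  suff -> : val s = t by [].
  by rewrite -(run_pad (val s)) run_cat run_w.
have [t [run_pad fg_t]] := PN _ (N_pad w).
have t_core : core_pred t.
  apply/asboolP; exists (size (pad ++ w)); split; last by exists (pad ++ w).
  move=> v v_sz p q; have [|t' [run_v _]] := PN v; first by rewrite v_sz.
  by rewrite !run_v.
exists (exist _ t t_core) => //; rewrite restrict_state_map.
by apply: (suffix_map_unique r0 fg_t); exact: suffix_map_cat.
Qed.

End Product.

(** * The topology of the Cantor spaces *)

Section CantorTopology.
Variable n : nat.

Lemma nbhs_cantor (x : cantor n) (A : set (cantor n)) :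
  nbhs x A <-> exists k, forall y, stream_take x k = stream_take y k -> A y.
Proof.
split; last first.
  move=> [k Ak]; apply: (@filterS _ _ _ _ _ Ak) => {A Ak}.
  elim: k => [|k IH]; first by apply: filterS filterT => y _.
  have xk : nbhs x ((fun y : cantor n => y k) @^-1` [set x k]).
    apply: (@proj_continuous nat (fun=> discrete_topology 'I_n) k x).
    exact: discrete_set1.
  apply: filterS2 IH xk => y xy yk; apply/stream_take_eq => i.
  rewrite ltnS leq_eqVlt => /orP[/eqP-> //|].
  by move/stream_take_eq : xy; apply.
(* It is enough that this filter of prefix neighbourhoods converges to x, and in the product
   topology that is checked one coordinate at a time. *)
pose G := filter_from [set: nat] (fun k => [set y | stream_take x k = stream_take y k]).
have G_filter : Filter G.
  apply: filter_from_filter; first by exists 0.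
  move=> i j _ _; exists (i + j) => // y /stream_take_eq xy.
  by split; apply/stream_take_eq => l lt; apply: xy; lia.
suff Gx : G --> x by move=> /Gx[k _ Ak]; exists k => y; exact: Ak.
apply/cvg_sup => i; apply/cvg_image => // [|B /= xB].
  apply/seteqP; split=> // a _; by exists (fun=> a).
exists [set y | B (y i)].
  exists i.+1 => // y /stream_take_eq/(_ i (ltnSn i)) /= <-.
  exact: nbhs_singleton.
apply/seteqP; split=> [_ [y By <-] //|a Ba].
by exists (fun=> a).
Qed.

Lemma nbhs_dcantor r (y : dcantor n r) (A : set (dcantor n r)) :
  nbhs y A <-> exists k, forall z, agree k y z -> A z.
Proof.
case: y => d x; split=> [[[B C] /= [dB /nbhs_cantor[k Ck]] BCA]|[k Ak]].
  exists k => -[e y] [/= <- xy]; apply: BCA; split=> /=; last exact: Ck.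
  exact: nbhs_singleton dB.
exists ([set d], [set y | stream_take x k = stream_take y k]) => /=.
  by split; [exact: discrete_set1|apply/nbhs_cantor; exists k].
by move=> [e y] [/= -> xy]; exact: Ak.
Qed.

Lemma continuousE r (f : dcantor n r -> dcantor n r) :
  continuous f <-> prefix_continuous f.
Proof.
split=> [f_cont y N|f_cont y A /nbhs_dcantor[N AN]].
  apply/nbhs_dcantor; apply: f_cont.
  by apply/nbhs_dcantor; exists N.
have [k fk] := f_cont y N; apply/nbhs_dcantor; exists k => z yz.
exact/AN/fk.
Qed.

End CantorTopology.

(** * Groups of bisynchronizing homeomorphisms *)

Section BisynchronizingPairs.
Variables n r : nat.
Hypotheses (n1 : 1 < n) (r0 : 0 < r).
Implicit Types f g h : dcantor n r -> dcantor n r.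

(** Membership in B_{n,r} with the inverse named and no transducer mentioned; [bisynchronizingP]
    gives the equivalence. *)
Definition bisynchronizing_pair g h : Prop :=
  [/\ mutually_inverse_homeos g h, exists m, synchronizing_map g m &
      exists m, synchronizing_map h m].

Lemma bisynchronizing_pair_sym g h :
  bisynchronizing_pair g h -> bisynchronizing_pair h g.
Proof. by move=> [[? ? ? ?] ? ?]. Qed.

Lemma bisynchronizing_pair_inj g h : bisynchronizing_pair g h -> injective g.
Proof. by move=> [[/can_inj]]. Qed.

Lemma pair_minimal_exists g h : bisynchronizing_pair g h ->
  exists A, [/\ minimal_for A g, finite_dtransducer A & strongly_synchronizing A].
Proof.
move=> [[/can_inj g_inj _ /continuousE g_cont _] [m g_sync] _].
have [A [A_min A_fin]] := minimal_exists n1 g_inj g_cont g_sync.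
exists A; split=> //; exists m.
exact: minimal_strongly_synchronizing (ltnW n1) A_min g_sync.
Qed.

Lemma pair_representable g h : bisynchronizing_pair g h -> fin_sync_representable g.
Proof.
move=> /pair_minimal_exists[A [A_min A_fin A_sync]]; exists A; split=> //.
by case: A_min.
Qed.

Lemma bisynchronizingP g :
  bisynchronizing g <-> exists h, bisynchronizing_pair g h.
Proof.
split=> [[h [gh [A [_ A_sync Ag]] [B [_ B_sync Bh]]]]|[h gh]].
  have [gK hK _ _] := gh; exists h; split=> //.
    exact: represents_synchronizing_map (can_inj gK) A_sync Ag.
  exact: represents_synchronizing_map (can_inj hK) B_sync Bh.
exists h; split; first by case: gh.
  exact: pair_representable gh.
exact: pair_representable (bisynchronizing_pair_sym gh).
Qed.

(** Whichever minimal transducer is taken as A_g, its core is coded by [core_maps g], so being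
    Core(A_g) becomes a condition on the set of state maps. *)
Lemma is_core_ofP g h T : bisynchronizing_pair g h ->
  is_core_of g T <-> coded T (core_maps g).
Proof.
move=> gh; have [_ [m g_sync] _] := gh; have n0 := ltnW n1.
split=> [[A [A_min TA]]|cT].
  exact: iso_coded TA (dcore_coded n0 r0 A_min g_sync).
have [A [A_min _ _]] := pair_minimal_exists gh; exists A; split=> //.
exact: coded_iso cT (dcore_coded n0 r0 A_min g_sync).
Qed.

Lemma pair_coded_exists g h : bisynchronizing_pair g h ->
  exists T : transducer n, coded T (core_maps g).
Proof.
move=> gh; have [A [A_min _ _]] := pair_minimal_exists gh.
have [_ [m g_sync] _] := gh; exists (dcore A).
exact: dcore_coded (ltnW n1) r0 A_min g_sync.
Qed.

Lemma bisynchronizing_pair_comp f f' g g' :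
  bisynchronizing_pair f f' -> bisynchronizing_pair g g' ->
  bisynchronizing_pair (f \; g) (g' \; f').
Proof.
move=> ff gg.
have sync_comp f1 f2 g1 g2 : bisynchronizing_pair f1 f2 ->
    bisynchronizing_pair g1 g2 -> exists m, synchronizing_map (f1 \; g1) m.
  (* A level for the composite depends on how fast the outputs of the first factor grow, hence the
     passage through cores. *)
  move=> f12 g12; have [T cT] := pair_coded_exists f12.
  have [U cU] := pair_coded_exists g12.
  have [[_ [mf f_sync] _] [_ [mg g_sync] _]] := (f12, g12).
  exact: (product_synchronizing n1 r0 (bisynchronizing_pair_inj f12)
    (bisynchronizing_pair_inj g12) f_sync g_sync cT cU).
split; first last.
- exact: sync_comp (bisynchronizing_pair_sym gg) (bisynchronizing_pair_sym ff).
- exact: sync_comp ff gg.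
have [[fK f'K f_cont f'_cont] _ _] := ff.
have [[gK g'K g_cont g'_cont] _ _] := gg.
split.
- by move=> x; rewrite /= gK fK.
- by move=> x; rewrite /= f'K g'K.
- by move=> x; apply: continuous_comp; [exact: f_cont|exact: g_cont].
- by move=> x; apply: continuous_comp; [exact: g'_cont|exact: f'_cont].
Qed.

Lemma pair_tmul_coded f f' g g' T U :
  bisynchronizing_pair f f' -> bisynchronizing_pair g g' ->
  coded T (core_maps f) -> coded U (core_maps g) ->
  coded (tmul T U) (core_maps (f \; g)).
Proof.
move=> ff gg; have [_ [mf f_sync] _] := ff; have [_ [mg g_sync] _] := gg.
exact: tmul_coded n1 r0 (bisynchronizing_pair_inj ff)
  (bisynchronizing_pair_inj gg) f_sync g_sync.
Qed.

Lemma bisynchronizing_pair_id : bisynchronizing_pair idfun idfun.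
Proof.
have id_sync : synchronizing_map (idfun : dcantor n r -> dcantor n r) 0.
  move=> w _; exists idfun => d v; split; last by exists (d, v ++ w).
  exists (fun=> Ordinal (ltnW n1)), (fun=> Ordinal n1).
  by move/(congr1 val).
split; last by exists 0.
- by split=> // x; exact: cvg_id.
- by exists 0.
Qed.

End BisynchronizingPairs.

(** * Passing from r to n - 1 dotted letters *)

Lemma synchronizing_core_maps n r s (g : dcantor n r -> dcantor n r)
    (G : dcantor n s -> dcantor n s) m : 0 < n -> 0 < s ->
  synchronizing_map g m ->
  (forall w a phi, suffix_map g w phi -> suffix_map G (a :: w) phi) ->
  synchronizing_map G m.+1 /\ core_maps G = core_maps g.
Proof.
(* The level grows by one because G may spend the letter a before g starts to read. *)
move=> n0 s0 g_sync gG; split=> [[//|a w] [wm]|].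
  by have [phi g_phi] := g_sync w wm; exists phi; exact: gG.
apply/seteqP; split=> [phi [w G_phi]|phi [w g_phi]]; last first.
  by exists (Ordinal n0 :: w); exact: gG.
(* With this padding g has a suffix map psi at v, and both phi and psi are suffix maps of G at v
   with one more letter in front. *)
pose v := nseq m (Ordinal n0) ++ w.
have mv : m <= size v by rewrite size_cat size_nseq leq_addr.
have [psi g_psi] := synchronizing_map_leq g_sync mv.
suff -> : phi = psi by exists v.
apply: (suffix_map_unique s0 _ (gG _ (Ordinal n0) _ g_psi)).
exact: (suffix_map_cat (Ordinal n0 :: nseq m (Ordinal n0)) G_phi).
Qed.

(* [C_{n,r'+k}], with n = r' + k + 1, splits into (r'+1)(r'+k) cylinders: expand
   the first r' dotted letters once. Hence it is a disjoint union of r' + k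
   copies of C_{n,r'+1}, on each of which [lift g] acts as g. *)
Section Lift.
Variables r' k : nat.
Local Notation n := (r' + k).+1.
Local Notation r := r'.+1.
Local Notation leaf_type := ('I_r' * 'I_n + 'I_k)%type.

Lemma card_leaf : #|{: leaf_type}| = #|{: 'I_(r' + k) * 'I_r}|.
Proof. rewrite card_sum !card_prod !card_ord; lia. Qed.

(** Any bijection serves: for a synchronizing g, the way leaves are distributed over the copies does
    not affect the core maps. *)
Definition pair_of_leaf (l : leaf_type) : 'I_(r' + k) * 'I_r :=
  enum_val (cast_ord card_leaf (enum_rank l)).
Definition leaf_of_pair (p : 'I_(r' + k) * 'I_r) : leaf_type :=
  enum_val (cast_ord (esym card_leaf) (enum_rank p)).

Lemma pair_of_leafK : cancel pair_of_leaf leaf_of_pair.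
Proof. by move=> l; rewrite /leaf_of_pair enum_valK cast_ordK enum_rankK. Qed.

Lemma leaf_of_pairK : cancel leaf_of_pair pair_of_leaf.
Proof. by move=> p; rewrite /pair_of_leaf enum_valK cast_ordKV enum_rankK. Qed.

Definition leaf (l : leaf_type) : dword n (r' + k) :=
  match l with
  | inl (c, a) => (lshift k c, [:: a])
  | inr c => (rshift r' c, [::])
  end.

Definition parse (y : dcantor n (r' + k)) : leaf_type * cantor n :=
  match fintype.split (y.1 : 'I_(r' + k)) with
  | inl c => (inl (c, y.2 0), stream_drop 1 y.2)
  | inr c => (inr c, y.2)
  end.

Lemma parseK y : dcat (leaf (parse y).1) (parse y).2 = y.
Proof.
case: y => d x; rewrite /parse/=; case: splitP => c dc /=; rewrite /dcat/=.
  congr pair; first exact: val_inj.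
  exact: (stream_take_drop 1).
by rewrite stream_cat0; congr pair; apply: val_inj.
Qed.

Lemma leafK l x : parse (dcat (leaf l) x) = (l, x).
Proof.
case: l => [[c a]|c]; rewrite /parse/dcat/=.
  by rewrite -[lshift _ _]/(unsplit (inl c)) unsplitK (stream_drop_cat [:: a]).
by rewrite -[rshift _ _]/(unsplit (inr c)) unsplitK stream_cat0.
Qed.

Definition to_copies (y : dcantor n (r' + k)) : 'I_(r' + k) * dcantor n r :=
  ((pair_of_leaf (parse y).1).1, ((pair_of_leaf (parse y).1).2, (parse y).2)).

Definition of_copies (z : 'I_(r' + k) * dcantor n r) : dcantor n (r' + k) :=
  dcat (leaf (leaf_of_pair (z.1, z.2.1))) z.2.2.

Lemma to_copiesK : cancel to_copies of_copies.
Proof.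
by move=> y; rewrite /of_copies/= -surjective_pairing pair_of_leafK parseK.
Qed.

Lemma of_copiesK : cancel of_copies to_copies.
Proof.
by move=> [i [c x]]; rewrite /to_copies /of_copies leafK leaf_of_pairK.
Qed.

Definition lift (g : dcantor n r -> dcantor n r) (y : dcantor n (r' + k)) :=
  of_copies ((to_copies y).1, g (to_copies y).2).

Lemma lift_cancel g h : cancel g h -> cancel (lift g) (lift h).
Proof.
move=> gK y; rewrite /lift of_copiesK.
by case: (to_copies y) (to_copiesK y) => i z /= yE; rewrite gK.
Qed.

Lemma lift_continuous g : prefix_continuous g -> prefix_continuous (lift g).
Proof.
move=> g_cont y N; have [j gj] := g_cont (to_copies y).2 N.
(* [parse] removes one letter after an expanded dotted letter, so one more letter has to agree. *)
exists j.+1 => z yz.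
have [yz1 yz2] : (parse y).1 = (parse z).1 /\
    stream_take (parse y).2 j = stream_take (parse z).2 j.
  move: yz; case: y z {gj} => [d x] [e x'] [/= <- /stream_take_eq xx].
  rewrite /parse /=; case: (fintype.split _) => c /=.
    rewrite xx//; split=> //; apply/stream_take_eq => i ij; exact: xx.
  by split=> //; apply/stream_take_eq => i ij; apply: xx; lia.
have [copies1 /gj] : (to_copies y).1 = (to_copies z).1 /\
    agree j (to_copies y).2 (to_copies z).2 by rewrite /to_copies yz1.
rewrite /lift -copies1; case: (g _) => e x; case: (g _) => e' x' [/= <- xx'].
split=> //=.
set w := (leaf _).2; apply/stream_take_eq => i iN.
have [iw|wi] := ltnP i (size w); first exact: set_nth_default.
by rewrite !stream_catE_ge//; move/stream_take_eq : xx'; apply; lia.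
Qed.

Lemma lift_suffix_map g w a phi :
  suffix_map g w phi -> suffix_map (lift g) (a :: w) phi.
Proof.
move=> g_phi d v; split; first by have [] := g_phi ord0 [::].
(* [parse] consumes at most the first letter b; thanks to a, this letter lies in front of w, and g
   still reads all of w. *)
have [b [v0 ->]] : exists b v0, v ++ a :: w = b :: v0 ++ w.
  case: v => [|b v]; first by exists a, [::].
  by exists b, (rcons v a); rewrite cat_rcons.
have [i [c [v' copiesE]]] : exists i c v', forall x,
    to_copies (dcat (d, b :: v0 ++ w) x) = (i, dcat (c, v' ++ w) x).
  have [l [v' parseE]] : exists l v', forall x,
      parse (dcat (d, b :: v0 ++ w) x) = (l, stream_cat (v' ++ w) x).
    rewrite /parse /=; case: (fintype.split d) => c.
      by exists (inl (c, b)), v0.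
    by exists (inr c), (b :: v0).
  by exists (pair_of_leaf l).1, (pair_of_leaf l).2, v' => x; rewrite /to_copies parseE.
have [_ [[e u] g_u]] := g_phi c v'.
exists ((leaf (leaf_of_pair (i, e))).1, (leaf (leaf_of_pair (i, e))).2 ++ u) => x.
by rewrite /lift copiesE g_u [RHS]dcat_cat.
Qed.

End Lift.

Lemma lift_pair n r (g h : dcantor n r -> dcantor n r) : 1 < n -> 0 < r < n ->
  bisynchronizing_pair g h -> exists G H : dcantor n n.-1 -> dcantor n n.-1,
  bisynchronizing_pair G H /\ core_maps G = core_maps g.
Proof.
case: r g h => // r g h n1 /= rn.
have [k nE] : exists k, n = (r + k).+1 by exists (n - r.+1); lia.
subst n => {rn} [[[gK hK /continuousE g_cont /continuousE h_cont]]].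
move=> [mg g_sync] [mh h_sync].
(* By conversion 1 < (r + k).+1 is 0 < r + k, so [n1] also proves that the number of dotted letters
   is positive. *)
have [G_sync G_core] :=
  synchronizing_core_maps (ltnW n1) n1 g_sync (@lift_suffix_map r k g).
have [H_sync _] :=
  synchronizing_core_maps (ltnW n1) n1 h_sync (@lift_suffix_map r k h).
exists (@lift r k g), (@lift r k h); split=> //; split.
- split; try exact: lift_cancel; exact/continuousE/lift_continuous.
- by exists mg.+1.
- by exists mh.+1.
Qed.

(** One direction is the lift; for the other, n - 1 is itself an admissible number of dotted
    letters. All factors of a product thus become maps of one space, where they compose. *)
Lemma some_outer_coreP n (T : transducer n) : 1 < n ->
  some_outer_core T <-> exists g h : dcantor n n.-1 -> dcantor n n.-1,
    bisynchronizing_pair g h /\ coded T (core_maps g).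
Proof.
move=> n1; split.
  move=> [r [rn [g [/bisynchronizingP g_bis g_core]]]].
  have r0 : 0 < r by case/andP: rn.
  have [h gh] := g_bis n1 r0; have [G [H [GH G_core]]] := lift_pair n1 rn gh.
  by exists G, H; split=> //; rewrite G_core; exact/(is_core_ofP n1 r0 _ gh).
move=> [g [h [gh cT]]]; have r0 : 0 < n.-1 by lia.
exists n.-1; split; first lia.
exists g; split; first by apply/bisynchronizingP => //; exists h.
exact/(is_core_ofP n1 r0 _ gh).
Qed.

Theorem theorem1p2 (n : nat) (hn : 2 <= n) :
  forms_group (@strongly_isomorphic n) (@some_outer_core n) (@tmul n) /\
  (forall r : nat, 1 <= r < n ->
   forall alpha beta : (dcantor n r -> dcantor n r) -> (dcantor n r -> dcantor n r),
     automorphism_of_higman_thompson alpha ->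
     automorphism_of_higman_thompson beta ->
   forall T U : transducer n,
     outer_class_is alpha T -> outer_class_is beta U ->
     outer_class_is (alpha \; beta) (tmul T U)).
Proof.
have r0 : 0 < n.-1 by lia.
split; last first.
  move=> r /andP[r1 rn] alpha beta [[alphaHT _ _] _] _ T U.
  move=> [f [/(bisynchronizingP hn r1)[f' ff] f_conj f_core]].
  move=> [g [/(bisynchronizingP hn r1)[g' gg] g_conj g_core]].
  have fg := bisynchronizing_pair_comp hn r1 ff gg.
  exists (f \; g); split.
  - by apply/bisynchronizingP => //; exists (g' \; f').
  (* Conjugation by f takes a to [alpha a], which again lies in G_{n,r}, so conjugation by g takes
     it on to [beta (alpha a)]. *)
  - move=> a a_HT; apply: funext => x /=.
    have := congr1 (@^~ (f x)) (g_conj _ (alphaHT _ a_HT)); rewrite /= => ->.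
    by have := congr1 (@^~ x) (f_conj _ a_HT); rewrite /= => ->.
  - apply/(is_core_ofP hn r1 _ fg); apply: (pair_tmul_coded _ _ ff gg) => //.
      exact/(is_core_ofP hn r1 _ ff).
    exact/(is_core_ofP hn r1 _ gg).
split.
- move=> x y /some_outer_coreP-/(_ hn)[f [f' [ff cx]]].
  move=> /some_outer_coreP-/(_ hn)[g [g' [gg cy]]].
  apply/some_outer_coreP => //; exists (f \; g), (g' \; f').
  by split; [exact: bisynchronizing_pair_comp|exact: (pair_tmul_coded _ _ ff gg)].
- move=> x x' y y' _ /some_outer_coreP-/(_ hn)[f [f' [ff cx']]] _.
  move=> /some_outer_coreP-/(_ hn)[g [g' [gg cy']]] xx yy.
  apply: (@coded_iso _ _ _ (core_maps (f \; g))).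
    by apply: (pair_tmul_coded _ _ ff gg) => //; apply: iso_coded; eassumption.
  exact: (pair_tmul_coded _ _ ff gg).
- move=> x y z /some_outer_coreP-/(_ hn)[f [f' [ff cx]]].
  move=> /some_outer_coreP-/(_ hn)[g [g' [gg cy]]].
  move=> /some_outer_coreP-/(_ hn)[h [h' [hh cz]]].
  have fg := bisynchronizing_pair_comp hn r0 ff gg.
  have gh := bisynchronizing_pair_comp hn r0 gg hh.
  apply: (@coded_iso _ _ _ (core_maps (f \; g \; h))).
    by apply: (pair_tmul_coded _ _ fg hh) => //; exact: (pair_tmul_coded _ _ ff gg).
  apply: (pair_tmul_coded (f := f) (g := g \; h) _ _ ff gh) => //.
  exact: (pair_tmul_coded _ _ gg hh).
(* The unit is the core of the identity of C_{n,n-1}, and the inverse of the core of f is the core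
   of the inverse of f. *)
have ii := @bisynchronizing_pair_id n n.-1 hn.
have [e ce] := pair_coded_exists hn r0 ii.
exists e; split; first by apply/some_outer_coreP => //; exists idfun, idfun.
- move=> x /some_outer_coreP-/(_ hn)[f [f' [ff cx]]]; split.
    apply: (@coded_iso _ _ _ (core_maps f)) => //.
    exact: (pair_tmul_coded hn r0 ii ff ce cx).
  apply: (@coded_iso _ _ _ (core_maps f)) => //.
  exact: (pair_tmul_coded hn r0 ff ii cx ce).
- move=> x /some_outer_coreP-/(_ hn)[f [f' [ff cx]]].
  have f'f := bisynchronizing_pair_sym ff.
  have [y cy] := pair_coded_exists hn r0 f'f.
  have [[fK f'K _ _] _ _] := ff.
  have fK1 : f \; f' = idfun by exact: funext.
  have f'K1 : f' \; f = idfun by exact: funext.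
  exists y; split.
  + by apply/some_outer_coreP => //; exists f', f.
  + apply: coded_iso ce; rewrite -fK1; exact: (pair_tmul_coded hn r0 ff f'f).
  + apply: coded_iso ce; rewrite -f'K1; exact: (pair_tmul_coded hn r0 f'f ff).
Qed.
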